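(* Let $\mathcal{M}_D$ be the matroid of the Desargues configuration, i.e. the rank $3$ matroid on $\{0,1,\dots,9\}$ whose nonbases are $$\{0,2,7\},\{0,3,6\},\{0,5,8\},\{1,3,5\},\{1,4,9\},\{1,6,8\},\{2,3,4\},\{2,5,9\},\{4,6,7\},\{7,8,9\}.$$ Modulo lineality and intersecting with a sphere, the Dressian $\mathrm{Dr}_{\mathcal{M}_D}$ is a $3$-dimensional polyhedral complex with $70$ vertices, $370$ edges, $510$ two-dimensional cells, and $150$ three-dimensional cells.
   Context: For a matroid $\mathcal{M}$ of rank $d$ on a finite set $E$ with bases $\mathcal{B}$, let $G_{\mathcal{M}}$ be the set of polynomials in the variables $p_\sigma$, $\sigma\in\mathcal{B}$, obtained from the three-term Plücker relations $p_{Sij}p_{Skl}-p_{Sik}p_{Sjl}+p_{Sil}p_{Sjk}$ ($S\in\binom{E}{d-2}$, $i,j,k,l$ distinct in $E\setminus S$, $Sij=S\cup\{i,j\}$) by replacing $p_\sigma$ by $0$ if $\sigma\notin\mathcal{B}$. For such $f$ (with coefficients $\pm1$), $\mathrm{trop}(V(f))\subset\mathbb{R}^{\mathcal{B}}$ is the set of $w$ at which the minimum of the linear forms $u\cdot w$, over the monomials $p^u$ of $f$, is attained at least twice (all of $\mathbb{R}^{\mathcal{B}}$ if $f=0$). The Dressian is $\mathrm{Dr}_{\mathcal{M}}=\bigcap_{f\in G_{\mathcal{M}}}\mathrm{trop}(V(f))$. The Dressian is a polyhedral fan, with the fan structure given by the common refinement of the tropical hypersurfaces $\mathrm{trop}(V(f))$,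 $f\in G_{\mathcal{M}}$. Its lineality space is the largest linear subspace $L$ with $w+u\in\mathrm{Dr}_{\mathcal{M}}$ for all $w\in\mathrm{Dr}_{\mathcal{M}}$, $u\in L$. ''Modulo lineality and intersecting with a sphere'' means: take the image of the fan in $\mathbb{R}^{\mathcal{B}}/L$ and intersect with a sphere centered at the origin, so that cones of dimension $\dim L+i+1$ become cells of dimension $i$. *)

(* Defs.v *)
From HB Require Import structures.
From mathcomp Require Import all_boot all_order all_algebra.
From mathcomp Require Import mpoly.
From mathcomp Require Import boolp classical_sets functions cardinality reals.
Set Implicit Arguments.
Unset Strict Implicit.
Unset Printing Implicit Defensive.
Import Order.TTheory GRing.Theory Num.Theory.
Local Open Scope ring_scope.
Local Open Scope classical_set_scope.
Local Open Scope card_scope.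

Record matroid (E : finType) (d : nat) := Matroid {
  bases : {set {set E}};
  bases_neq0 : bases != finset.set0;
  card_bases : forall A, A \in bases -> #|A| = d;
  bases_exchange : forall A B, A \in bases -> B \in bases ->
    forall x, x \in A :\: B ->
      exists2 y, y \in B :\: A & y |: (A :\ x) \in bases }.

Definition basis (E : finType) (d : nat) (M : matroid E d) : finType :=
  {A : {set E} | A \in bases M}.

(* p_A is replaced by 0 when A is not a basis; the variables of the polynomial
   ring are numbered by [enum_rank]. *)
Definition plucker_var (E : finType) (d : nat) (M : matroid E d) (A : {set E}) :
    {mpoly int[#|basis M|]} :=
  if insub A is Some b then 'X_(enum_rank (b : basis M)) else 0.

Definition three_term (E : finType) (d : nat) (M : matroid E d)
    (S : {set E}) (i j k l : E) : {mpoly int[#|basis M|]} :=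
  let p a b := plucker_var M (a |: (b |: S)) in
  p i j * p k l - p i k * p j l + p i l * p j k.

Definition three_term_relations (E : finType) (d : nat) (M : matroid E d) :
    set {mpoly int[#|basis M|]} :=
  [set f | exists (S : {set E}) (i j k l : E),
     [/\ (#|S| + 2 = d)%N, uniq [:: i; j; k; l],
         all (fun a => a \notin S) [:: i; j; k; l]
       & f = three_term M S i j k l]].

Arguments three_term_relations {E d} M _.

(* The valuation is trivial on the coefficients, so only the monomials of a
   polynomial matter.  The space R^B is [{ffun B -> R^o}]. *)

Section Tropical.
Variables (R : realType) (B : finType).
Implicit Types (f : {mpoly int[#|B|]}) (u : 'X_{1..#|B|}).
Implicit Types (v w : {ffun B -> R^o}).

Definition trop_monomial u w : R :=
  \sum_(b : B) (u (enum_rank b))%:R * w b.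

Definition attains_min f w u : Prop :=
  u \in msupp f /\
  forall u', u' \in msupp f -> trop_monomial u w <= trop_monomial u' w.

Definition trop_hypersurface f : set {ffun B -> R^o} :=
  [set w | f = 0 \/
     exists u1 u2, [/\ u1 != u2, attains_min f w u1 & attains_min f w u2]].

(* The closed cone, in the inner normal fan of the Newton polytope of f, that
   contains v in its relative interior. *)
Definition trop_cone f v : set {ffun B -> R^o} :=
  [set w | forall u, attains_min f v u -> attains_min f w u].

Definition trop_fan f : set (set {ffun B -> R^o}) :=
  trop_cone f @` trop_hypersurface f.

End Tropical.

(* A fan is represented by the set of its cones. *)
Definition common_refinement (T I : Type) (D : set I) (F : I -> set (set T)) :
    set (set T) :=
  [set C | exists c : I -> set T,
     (forall i, D i -> F i (c i)) /\ C = \bigcap_(i in D) c i].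

Definition dressian (R : realType) (E : finType) (d : nat) (M : matroid E d) :
    set {ffun basis M -> R^o} :=
  \bigcap_(f in three_term_relations M) trop_hypersurface f.

Arguments dressian R {E d} M _.

Definition dressian_fan (R : realType) (E : finType) (d : nat)
    (M : matroid E d) : set (set {ffun basis M -> R^o}) :=
  common_refinement (three_term_relations M) (fun f => trop_fan f).

Arguments dressian_fan R {E d} M _.

Definition stable_by_translation (R : realType) (V : vectType R)
    (X : set V) (L : {vspace V}) : Prop :=
  forall w u, X w -> u \in L -> X (w + u).

Definition is_lineality_space (R : realType) (V : vectType R)
    (X : set V) (L : {vspace V}) : Prop :=
  stable_by_translation X L /\
  forall L' : {vspace V}, stable_by_translation X L' -> (L' <= L)%VS.

Section SphericalComplex.
Variables (R : realType) (W : vectType R).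
Variables (dot : {dot W for @idfun R}) (r : R).
Implicit Types (C D F : set W) (K : set (set W)).

Definition sphere : set W := [set x | dot x x = r ^+ 2].

Definition polyhedral_cone C : Prop :=
  exists s : seq 'Hom(W, R^o),
    C = [set x | forall l, l \in s -> 0 <= (l x : R)].

Definition pointed C : Prop := forall x, C x -> C (- x) -> x = 0.

Definition spherical_polytope D : Prop :=
  exists C, [/\ polyhedral_cone C, pointed C & D = C `&` sphere].

Definition is_face F D : Prop :=
  exists l : 'Hom(W, R^o),
    (forall x, D x -> 0 <= (l x : R)) /\ F = D `&` [set x | l x = 0].

(* The empty cell is left out of K. *)
Definition spherical_complex K : Prop :=
  [/\ finite_set K,
      forall D, K D -> spherical_polytope D /\ D !=set0,
      forall D F, K D -> is_face F D -> F !=set0 -> K F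
    & forall D1 D2, K D1 -> K D2 -> D1 `&` D2 !=set0 ->
        is_face (D1 `&` D2) D1 /\ is_face (D1 `&` D2) D2].

Definition is_linear_span D (U : {vspace W}) : Prop :=
  (forall x, D x -> x \in U) /\
  forall U' : {vspace W}, (forall x, D x -> x \in U') -> (U <= U')%VS.

(* A cone of dimension dim L + i + 1 has an (i + 1)-dimensional image modulo the
   lineality space L.  The section of an (i + 1)-dimensional cone by a sphere has dimension i. *)
Definition cell_dim D (i : nat) : Prop :=
  exists2 U : {vspace W}, is_linear_span D U & \dim U = i.+1.

Definition complex_dim K (n : nat) : Prop :=
  (exists2 D, K D & cell_dim D n) /\
  forall D i, K D -> cell_dim D i -> (i <= n)%N.

Definition cells K (i : nat) : set (set W) := [set D | K D /\ cell_dim D i].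

Definition spherical_section (V : vectType R) (proj : 'Hom(V, W))
    (fan : set (set V)) : set (set W) :=
  [set D | D !=set0 /\ exists2 C, fan C & D = (proj @` C) `&` sphere].

End SphericalComplex.

Definition desargues_lines : seq (seq nat) :=
  [:: [:: 0; 2; 7]; [:: 0; 3; 6]; [:: 0; 5; 8]; [:: 1; 3; 5]; [:: 1; 4; 9];
      [:: 1; 6; 8]; [:: 2; 3; 4]; [:: 2; 5; 9]; [:: 4; 6; 7]; [:: 7; 8; 9]]%N.

Definition desargues_nonbases : seq {set 'I_10} :=
  [seq [set i : 'I_10 | val i \in l]%SET | l <- desargues_lines].

Definition desargues_bases : {set {set 'I_10}} :=
  [set A : {set 'I_10} | (#|A| == 3) && (A \notin desargues_nonbases)]%SET.

Lemma desargues_lines_meet l1 l2 x y :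
  l1 \in desargues_lines -> l2 \in desargues_lines -> (x != y)%N ->
  x \in l1 -> x \in l2 -> y \in l1 -> y \in l2 -> l1 = l2.
Proof.
have : all (fun l1 : seq nat => all (fun l2 : seq nat => all (fun x => all (fun y =>
   [&& x != y, x \in l2 & y \in l2] ==> (l1 == l2)) l1) l1)
     desargues_lines) desargues_lines by vm_compute.
move=> /allP h h1 h2 xy x1 x2 y1 y2.
move: (h _ h1) => /allP /(_ _ h2) /allP /(_ _ x1) /allP /(_ _ y1).
by rewrite xy x2 y2 => /eqP.
Qed.

Lemma desargues_nonbases_meet A B x y :
  A \in desargues_nonbases -> B \in desargues_nonbases -> x != y ->
  x \in A -> x \in B -> y \in A -> y \in B -> A = B.
Proof.
move=> /mapP[l1 h1 ->] /mapP[l2 h2 ->] xy; rewrite !inE => x1 x2 y1 y2.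
by rewrite (desargues_lines_meet h1 h2 _ x1 x2 y1 y2).
Qed.

Lemma desargues_bases_neq0 : desargues_bases != finset.set0.
Proof.
apply/set0Pn; exists [set i in [:: @Ordinal 10 0 isT; @Ordinal 10 1 isT;
                                    @Ordinal 10 2 isT]]%SET.
rewrite inE; apply/andP; split; first by rewrite cardsE; apply/eqP/card_uniqP.
apply/mapP => -[l hl] /setP e.
have e0 : 0%N \in l by have := e (@Ordinal 10 0 isT); rewrite !inE.
have e1 : 1%N \in l by have := e (@Ordinal 10 1 isT); rewrite !inE.
have : all (fun l => ~~ ((0%N \in l) && (1%N \in l))) desargues_lines by [].
by move=> /allP /(_ _ hl); rewrite e0 e1.
Qed.

Lemma card_desargues_bases A : A \in desargues_bases -> #|A| = 3.
Proof. by rewrite inE => /andP[/eqP]. Qed.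

Lemma desargues_bases_exchange A B :
  A \in desargues_bases -> B \in desargues_bases ->
  forall x, x \in A :\: B ->
    exists2 y, y \in B :\: A & y |: (A :\ x) \in desargues_bases.
Proof.
move=> hA hB x hx; move: (hx); rewrite inE => /andP[xB xA].
have cA := card_desargues_bases hA; have cB := card_desargues_bases hB.
have cAx : #|A :\ x| = 2 by move: (cardsD1 x A); rewrite xA cA => -[].
case: (pickP [pred y | (y \in B :\: A) &&
         (y |: (A :\ x) \in desargues_bases)]) => [y /andP[]|h].
  by exists y.
have nb y : y \in B :\: A -> y |: (A :\ x) \in desargues_nonbases.
  move=> yBA; have := h y; rewrite /= yBA /= inE cardsU1 cAx.
  move: yBA; rewrite !inE => /andP[/negbTE yA _].
  by rewrite yA andbF /= => /negbFE.
have [a [b [ab eab]]] : exists a b, a != b /\ A :\ x = [set a; b]%SET.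
  by apply/cards2P; rewrite cAx.
have [y0 y0BA] : exists y, y \in B :\: A.
  apply/set0Pn; rewrite -cards_eq0.
  have := cardsID A B; have := cardsID B A; rewrite cA cB finset.setIC => e1 e2.
  have : (0 < #|A :\: B|)%N by apply/card_gt0P; exists x.
  by case: #|B :\: A| e2 => // e2; move: e1; rewrite -e2 addn0 => /eqP;
     rewrite -[X in _ == X]addn0 eqn_add2l => /eqP ->.
have sB : B \subset y0 |: (A :\ x).
  apply/fintype.subsetP => z zB; case: (boolP (z \in A)) => zA.
    have zx : z != x by apply: contraNneq xB => <-.
    by rewrite !inE zA zx orbT.
  have zBA : z \in B :\: A by rewrite inE zA.
  suff -> : y0 |: (A :\ x) = z |: (A :\ x) by rewrite setU11.
  by apply: (desargues_nonbases_meet (nb _ y0BA) (nb _ zBA) ab);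
     rewrite eab !inE eqxx ?orbT.
have eB : B = y0 |: (A :\ x).
  apply/eqP; rewrite eqEcard sB cB cardsU1 cAx.
  by case: (_ \notin _).
by move: hB; rewrite inE {2}eB nb // andbF.
Qed.

Definition desargues : matroid 'I_10 3 :=
  Matroid desargues_bases_neq0 card_desargues_bases desargues_bases_exchange.

(* Main.v *)
From HB Require Import structures.
From mathcomp Require Import all_boot all_order all_algebra.
From mathcomp Require Import mpoly.
From mathcomp Require Import boolp classical_sets functions cardinality reals.
From mathcomp Require Import zify ring lra.
Require Import Defs.
Set Implicit Arguments.
Unset Strict Implicit.
Unset Printing Implicit Defensive.
Import Order.TTheory GRing.Theory Num.Theory.

(* The ten points of the Desargues configuration are the edges of K5 and its ten
   lines are the triangles: cut the ten lines joining five generic points q_i of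
   P^3 with a plane h.  The determinants of the realizations are products of two
   of the fifteen linear forms h_i, h_i + h_j, where h_i = h(q_i) and sum h_i = 0.
   Tropically, modulo lineality the binomial Plucker relations cut out the vectors
   w_sigma = x_a + x_b, x in R^15 / R, and the three-term ones become 55 trinomials
   in x: 25 of degree one and 30 of degree two.

   A cone of the fan is determined by its signature, the set of minimal monomials
   of each relation.  Starting from the cone generated by the unit vectors, each
   linear trinomial is imposed by stellar subdivision, until R^15 is cut down to
   385 simplicial cones with 70 rays covering the Dressian.  The signature of a
   nonnegative combination of generators is the intersection of their signatures,
   hence the signatures are found by enumeration (1101 of them, one being that of
   the lineality space), and the dimension of a cone is the rank of the rays whose
   signature contains its own.  That these cones, cut by a sphere, form a complex
   holds for any prevariety. *)

(** * Fans of tropical prevarieties *)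

Section TropicalFans.
Local Open Scope ring_scope.
Local Open Scope classical_set_scope.
Local Open Scope card_scope.

(** The pieces are never shown to form a fan and no two of them are ever intersected: they may
    overlap, and everything said about them passes through signatures. That no point of the Dressian
    is lost holds for every splitting and pruning step, whatever the heuristics choose. Conversely,
    for each set of generators of a piece the meet of the signatures is checked to keep two minimal
    monomials in each of the 55 trinomials. This one check makes every meet the signature of a real
    point of the Dressian and makes the signature of a positive combination equal to the meet, so
    the list of signatures is exact. It also disposes of the 30 quadratic trinomials: only the 25
    linear ones are imposed (the [zip] in [pieces] stops there), and the quadratic ones are then
    seen to hold on all pieces. The coordinates x of a vector w among the 110 bases are not
    canonical: x may change by a multiple of the all-one vector, and w carries a torus part
    depending on the points. Hence w and x are linked by a relation, [models], instead of a chosen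
    isomorphism of quotients. *)

Lemma small_scaling (R : realFieldType) (s : seq (R * R)) :
  (forall p, p \in s -> 0 < p.1) ->
  exists2 e, 0 < e & forall p, p \in s -> e * p.2 <= p.1.
Proof.
elim: s => [|[a b] s IH] h; first by exists 1.
have [e e0 he] : exists2 e, 0 < e & forall p, p \in s -> e * p.2 <= p.1.
  by apply: IH => p ps; apply: h; rewrite inE ps orbT.
have a0 : 0 < a by apply: (h (a, b)); rewrite inE eqxx.
have b0 : 0 < `|b| + 1 by rewrite ltr_wpDl.
exists (Num.min e (a / (`|b| + 1))); first by rewrite lt_min e0 divr_gt0.
have m0 : 0 <= Num.min e (a / (`|b| + 1)).
  by rewrite le_min ltW //= ltW // divr_gt0.
move=> p; rewrite inE => /orP[/eqP -> /=|ps].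
  apply: (@le_trans _ _ (Num.min e (a / (`|b| + 1)) * (`|b| + 1))).
    by apply: ler_wpM2l => //; rewrite (le_trans (ler_norm _)) // lerDl.
  by rewrite -ler_pdivlMr // ge_min lexx orbT.
have [pb|pb] := leP p.2 0.
  apply: (@le_trans _ _ 0); first by rewrite mulr_ge0_le0.
  by rewrite ltW // h // inE ps orbT.
apply: le_trans (he _ ps); rewrite ler_wpM2r ?(ltW pb) //.
by rewrite ge_min lexx.
Qed.

Section TropicalFan.
Variables (R : realType) (B : finType).
Local Notation V := {ffun B -> R^o}.
Implicit Types (f : {mpoly int[#|B|]}) (u : 'X_{1..#|B|}).
Implicit Types (v w : V).

Lemma trop_monomial_is_linear u : linear (@trop_monomial R B u : V -> R^o).
Proof.
move=> a v w; rewrite /trop_monomial scaler_sumr -big_split /=.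
by apply: eq_bigr => b _; rewrite !ffunE /= /GRing.scale /= mulrDr mulrCA.
Qed.
HB.instance Definition _ u := GRing.isLinear.Build R V R^o _
  (@trop_monomial R B u : V -> R^o) (trop_monomial_is_linear u).

Definition trop_form u : 'Hom(V, R^o) := linfun (@trop_monomial R B u : V -> R^o).

Lemma trop_formE u v : trop_form u v = trop_monomial u v :> R.
Proof. by rewrite lfunE. Qed.

Lemma trop_formB u u' v :
  (trop_form u - trop_form u') v = trop_monomial u v - trop_monomial u' v :> R.
Proof. by rewrite add_lfunE opp_lfunE !trop_formE. Qed.

Lemma trop_monomialD u v w :
  trop_monomial u (v + w) = trop_monomial u v + trop_monomial u w.
Proof. exact: (raddfD (@trop_monomial R B u : {linear V -> R^o})). Qed.

Lemma trop_monomialZ u (a : R) v : trop_monomial u (a *: v) = a * trop_monomial u v.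
Proof.
rewrite -[a *: v]addr0; move: (trop_monomial_is_linear u a v 0) => /= ->.
by rewrite (linear0 (@trop_monomial R B u : {linear V -> R^o})) addr0.
Qed.

Lemma trop_monomial0 u : trop_monomial u (0 : V) = 0.
Proof. exact: (linear0 (@trop_monomial R B u : {linear V -> R^o})). Qed.

Lemma trop_monomialN u v : trop_monomial u (- v) = - trop_monomial u v.
Proof. exact: (linearN (@trop_monomial R B u : {linear V -> R^o})). Qed.

Lemma attains_min0 f u : u \in msupp f -> attains_min f (0 : V) u.
Proof. by move=> uf; split=> // u' _; rewrite !trop_monomial0. Qed.

Lemma attains_min_same f v u u' : attains_min f v u -> attains_min f v u' ->
  trop_monomial u v = trop_monomial u' v.
Proof. by move=> [uf hu] [u'f hu']; apply/eqP; rewrite eq_le hu ?hu'. Qed.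

Lemma attains_minE f v u u' : attains_min f v u -> u' \in msupp f ->
  attains_min f v u' <-> trop_monomial u' v = trop_monomial u v.
Proof.
move=> hu u'f; split=> [hu'|e]; first exact: attains_min_same hu' hu.
by split=> // u'' u''f; rewrite e; apply: hu.2.
Qed.

(** With a common minimizer [u], the minimum of the sum is the sum of the minima, so a minimizer of
    the sum must attain both. This is why intersections of sets of minimal monomials describe sums
    of points. *)
Lemma attains_minD f v w u u' : attains_min f v u -> attains_min f w u ->
  attains_min f (v + w) u' <-> attains_min f v u' /\ attains_min f w u'.
Proof.
move=> hv hw; split=> [[u'f h]|[[u'f hv'] [_ hw']]].
  have := h _ hv.1; rewrite !trop_monomialD => h'.
  have lv := hv.2 _ u'f; have lw := hw.2 _ u'f.
  have ev : trop_monomial u' v = trop_monomial u v.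
    apply/eqP; rewrite eq_le lv andbT -(lerD2r (trop_monomial u' w)).
    by rewrite (le_trans h') // lerD2l.
  have ew : trop_monomial u' w = trop_monomial u w.
    apply/eqP; rewrite eq_le lw andbT -(lerD2l (trop_monomial u' v)).
    by rewrite (le_trans h') // lerD2r.
  by split; split=> // u'' u''f; rewrite ?ev ?ew ?hv.2 ?hw.2.
by split=> // u'' u''f; rewrite !trop_monomialD lerD ?hv' ?hw'.
Qed.

Lemma attains_minZ f v u (a : R) : 0 < a ->
  attains_min f (a *: v) u <-> attains_min f v u.
Proof.
move=> a0; split=> -[uf h]; split=> // u' u'f; have := h _ u'f;
  by rewrite !trop_monomialZ ler_pM2l.
Qed.

Lemma exists_attains_min f v : f != 0 -> exists u, attains_min f v u.
Proof.
move=> f0; suff h (s : seq 'X_{1..#|B|}) : s != [::] -> exists2 u, u \in s &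
    forall u', u' \in s -> trop_monomial u v <= trop_monomial u' v.
  case: (h (msupp f)) => [|u uf hu]; last by exists u.
  by rewrite msupp_eq0.
elim: s => // u s IH _; case: (eqVneq s [::]) => [->|/IH[u' u's hu']].
  by exists u; rewrite ?mem_head // => u'; rewrite inE => /eqP ->.
have [le|lt] := leP (trop_monomial u v) (trop_monomial u' v).
  exists u; first exact: mem_head.
  move=> u''; rewrite inE => /orP[/eqP -> //|/hu']; exact: le_trans.
exists u'; first by rewrite inE u's orbT.
by move=> u''; rewrite inE => /orP[/eqP ->|/hu' //]; exact: ltW.
Qed.

Variable fs : seq {mpoly int[#|B|]}.

(* [min_le v w]: w lies in the cone of the common refinement that has v in its
   relative interior. *)
Definition min_le v w : Prop :=
  forall f, f \in fs -> forall u, attains_min f v u -> attains_min f w u.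
Definition fan_cone v : set V := [set w | min_le v w].
Definition trop_prevariety : set V :=
  [set w | forall f, f \in fs -> trop_hypersurface f w].

Lemma min_le_refl v : min_le v v.
Proof. by []. Qed.

Lemma min_le_trans v1 v2 v3 : min_le v1 v2 -> min_le v2 v3 -> min_le v1 v3.
Proof. by move=> h1 h2 f ff u /(h1 f ff)/(h2 f ff). Qed.

Lemma min_le0 v : min_le v 0.
Proof. by move=> f _ u [uf _]; apply: attains_min0. Qed.

Lemma min_leD v w w' : min_le v w -> min_le v w' -> min_le v (w + w').
Proof.
by move=> h h' f ff u hu; apply/(attains_minD u (h f ff u hu) (h' f ff u hu)); split;
   [apply: h|apply: h'].
Qed.

Lemma min_leZ v w (a : R) : 0 <= a -> min_le v w -> min_le v (a *: w).
Proof.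
rewrite le_eqVlt => /orP[/eqP <- _|a0 h]; first by rewrite scale0r; apply: min_le0.
by move=> f ff u hu; apply/attains_minZ => //; apply: h.
Qed.

Lemma min_le_prevariety v w : min_le v w -> trop_prevariety v -> trop_prevariety w.
Proof.
move=> h hv f ff; case: (hv f ff) => [->|[u1 [u2 [n h1 h2]]]]; first by left.
by right; exists u1, u2; split=> //; apply: h.
Qed.

(* A point of C minimizing the total number of minimal monomials. *)
Lemma generic_point (C : set V) : C !=set0 ->
  (forall v w, C v -> C w -> C (v + w)) ->
  (forall v w f, C v -> C w -> f \in fs -> f != 0 ->
     exists2 u, attains_min f v u & attains_min f w u) ->
  exists2 v, C v & forall w, C w -> min_le v w.
Proof.
move=> [v0 Cv0] CD Ccommon.
pose n f v := count (fun u => `[< attains_min f v u >]) (msupp f).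
pose N v := (\sum_(f <- fs) n f v)%N.
have [v Cv vmin] : exists2 v, C v & forall w, C w -> (N v <= N w)%N.
  have ex : exists k, `[< exists2 v, C v & N v = k >].
    by exists (N v0); apply/asboolP; exists v0.
  case: (ex_minnP ex) => k /asboolP[v Cv Nv] kmin; exists v => // w Cw.
  by rewrite Nv; apply: kmin; apply/asboolP; exists w.
exists v => // w Cw f ff u hu.
have f0 : f != 0.
  by apply/eqP => f0; move: hu.1; rewrite f0 msupp0.
have [u0 hv0 hw0] := Ccommon _ _ _ Cv Cw ff f0.
(* Passing from [v] to [v + w] can only remove minimal monomials, while [v] minimizes their total
   number. Hence nothing is removed for any relation, and a monomial minimal at [v] is still minimal
   at [v + w], hence at [w]. *)
have le_n g : g \in fs -> (n g (v + w)%R <= n g v)%N.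
  move=> gf; case: (eqVneq g 0) => [->|g0]; first by rewrite /n msupp0.
  have [u1 hv1 hw1] := Ccommon _ _ _ Cv Cw gf g0.
  by apply: sub_count => u2 /asboolP /(attains_minD u2 hv1 hw1)[? _]; apply/asboolP.
have le_N : (N v <= N (v + w)%R)%N by apply: vmin; apply: CD.
have {le_N} en : n f (v + w) = n f v.
  apply/eqP; rewrite eqn_leq le_n //= leqNgt; apply/negP => lt.
  move: le_N; rewrite leqNgt => /negP; apply.
  rewrite /N [X in (X < _)%N](perm_big _ (perm_to_rem ff)) [X in (_ < X)%N](perm_big _
    (perm_to_rem ff)).
  rewrite !big_cons -addSn leq_add // big_seq [X in (_ <= X)%N]big_seq.
  by apply: leq_sum => g /mem_rem; apply: le_n.
have uf := hu.1.
have : all (fun u1 => `[<attains_min f v u1>] ==> `[<attains_min f (v + w) u1>]) (msupp f).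
  move: en; rewrite /n; elim: (msupp f) => //= u1 s IH.
  have sub s' : (count (fun u => `[< attains_min f (v + w)%R u >]) s' <=
             count (fun u => `[< attains_min f v u >]) s')%N.
    by apply: sub_count => u2 /asboolP /(attains_minD u2 hv0 hw0)[? _]; apply/asboolP.
  case: asboolP => h1; case: asboolP => h2 //=.
  - by move=> e; apply: IH; lia.
  - by move/(attains_minD u1 hv0 hw0): h1 => [].
  - by move=> e; have := sub s; rewrite -ltnS -[X in (X < _)%N]add0n e ltnn.
move=> /allP/(_ u uf); have -> : `[<attains_min f v u>] by apply/asboolP.
by move=> /asboolP /(attains_minD u hv0 hw0)[].
Qed.

(** The refinement allows any choice of one cone per relation, and the intersection may miss the
    relative interiors of the chosen cones. A generic point [v] of the intersection repairs this:
    the intersection is exactly [fan_cone v]. *)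
Lemma fan_cones :
  common_refinement [set` fs] (fun f => @trop_fan R B f) =
  [set C | exists2 v, trop_prevariety v & C = fan_cone v].
Proof.
apply/seteqP; split=> [C [c [hc ->]]|C [v hv ->]]; last first.
  exists (fun f => trop_cone f v); split=> [f ff|].
    by exists v => //; apply: hv.
  by apply/seteqP; split=> [w h f ff u|w h f ff u]; apply: h.
have common v w f u : f \in fs -> (c f) v -> (c f) w -> f != 0 ->
  exists2 u, attains_min f v u & attains_min f w u.
  move=> /hc [x _ <-] hv hw f0; have [u' hu'] := exists_attains_min x f0.
  by exists u'; [apply: hv|apply: hw].
case: (@generic_point (\bigcap_(f in [set` fs]) c f)).
- exists 0 => f /hc[x _ <-] u [uf _]; exact: attains_min0.
- move=> v w hv hw f ff; move: (hv f ff) (hw f ff); have [x _ <-] := hc f ff.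
  by move=> h h' u hu; apply/(attains_minD u (h u hu) (h' u hu)); split; [apply: h|apply: h'].
- by move=> v w f hv hw ff; apply: (common _ _ _ 0%MM) => //; [apply: hv|apply: hw].
move=> v hv vmin; exists v => [f ff|].
  move: (hv f ff); have [x xf <-] := hc f ff; case: xf => [->|[u1 [u2 [n h1 h2]]] h]; first by left.
  by right; exists u1, u2; split=> //; apply: h.
apply/seteqP; split=> [w /vmin //|w h f ff].
move: (hv f ff); have [x _ <-] := hc f ff; move=> hx u /hx; exact: h.
Qed.

(** Take [v] generic in the face. If [w] lies in [fan_cone v], then [v - e *: w] stays in the cone
    of [v0] for small [e], so [l] is nonnegative at both [w] and [- w]; hence [l w = 0]. *)
Lemma fan_cone_face v0 (l : 'Hom(V, R^o)) :
  (forall w, fan_cone v0 w -> 0 <= (l w : R)) ->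
  exists v, [/\ min_le v0 v, l v = 0 & fan_cone v0 `&` [set w | l w = 0] = fan_cone v].
Proof.
move=> l0; case: (@generic_point (fan_cone v0 `&` [set w | l w = 0])).
- by exists 0; split; [apply: min_le0|rewrite /= linear0].
- move=> v w [hv /= lv] [hw /= lw]; split; first exact: min_leD.
  by rewrite /= linearD /= lv lw addr0.
- move=> v w f [hv _] [hw _] ff f0; have [u hu] := exists_attains_min v0 f0.
  by exists u; [apply: hv|apply: hw].
move=> v [hv /= lv] vmin; exists v; split=> //.
apply/seteqP; split=> [w hw|w hw]; first exact: vmin.
have hw0 : fan_cone v0 w by apply: min_le_trans hv hw.
split=> //=; apply/eqP; rewrite eq_le l0 // andbT.
(* Each pair records the gap between two monomials at [v] and at [w]. A positive gap at [v] survives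
   the subtraction of [e *: w]; a monomial tied with the minimum at [v] is minimal at [w] too, so
   its gap stays zero. *)
pose s := flatten [seq [seq (trop_monomial p.1 v - trop_monomial p.2 v,
   trop_monomial p.1 w - trop_monomial p.2 w) | p <- [seq (u', u) | u' <- msupp f, u <- msupp f]]
     | f <- fs].
have [p hp|e e0 he] := @small_scaling _ [seq p <- s | 0 < p.1].
  by move: hp; rewrite mem_filter => /andP[].
suff /l0 : fan_cone v0 (v - e *: w).
  by rewrite linearB linearZ /= lv sub0r oppr_ge0 pmulr_rle0.
move=> f ff u hu; split; first exact: hu.1.
move=> u' u'f; rewrite !trop_monomialD !trop_monomialN !trop_monomialZ.
have huv := hv f ff u hu.
have := huv.2 _ u'f; rewrite le_eqVlt => /orP[/eqP eq|lt].
  have hu'v : attains_min f v u' by apply/(attains_minE huv).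
  rewrite eq (attains_min_same (hw f ff _ hu'v) (hw f ff _ huv)) //.
suff : e * (trop_monomial u' w - trop_monomial u w) <=
    trop_monomial u' v - trop_monomial u v by rewrite mulrBr; lra.
apply: (he (_, _)); rewrite mem_filter /= subr_gt0 lt /=.
apply/flatten_mapP; exists f => //; apply/mapP; exists (u', u) => //.
by apply/allpairsP; exists (u', u); split=> //; apply: hu.1.
Qed.

(** The form adds up, over the monomials minimal at [v2], their gaps above a monomial minimal at
    [v1]. On the cone of [v1] all gaps are nonnegative, so the sum vanishes exactly when every
    monomial minimal at [v2] is minimal, that is, on the cone of [v2]. *)
Lemma fan_cone_meet v1 v2 :
  exists l : 'Hom(V, R^o),
    [/\ forall w, fan_cone v1 w -> 0 <= (l w : R),
        forall w, (forall f, f \in fs -> forall u u', u \in msupp f -> u' \in msupp f ->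
           trop_monomial u w = trop_monomial u' w) -> l w = 0
      & fan_cone v1 `&` fan_cone v2 = fan_cone v1 `&` [set w | l w = 0]].
Proof.
have ex f : exists u, f != 0 -> attains_min f v1 u.
  by case: (eqVneq f 0) => [_|/(exists_attains_min v1)[u hu]]; [exists 0%MM|exists u].
have [m hm] := choice ex.
pose l : 'Hom(V, R^o) := \sum_(f <- fs) \sum_(u <- msupp f | `[<attains_min f v2 u>])
   (trop_form u - trop_form (m f)).
have lE w : l w = \sum_(f <- fs) \sum_(u <- msupp f | `[<attains_min f v2 u>])
   (trop_monomial u w - trop_monomial (m f) w) :> R.
  rewrite sum_lfunE; apply: eq_bigr => f _; rewrite sum_lfunE; apply: eq_bigr => u _.
  by rewrite trop_formB.
have supp_neq0 f u : u \in msupp f -> f != 0.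
  by move=> uf; apply/eqP => f0; move: uf; rewrite f0 msupp0.
have term_ge0 w f u : fan_cone v1 w -> f \in fs -> u \in msupp f ->
    0 <= trop_monomial u w - trop_monomial (m f) w.
  move=> hw ff uf; rewrite subr_ge0.
  exact: (hw f ff _ (hm f (supp_neq0 _ _ uf))).2.
exists l; split.
- move=> w hw; rewrite lE big_seq sumr_ge0 // => f ff.
  by rewrite big_seq_cond sumr_ge0 // => u /andP[uf _]; apply: term_ge0.
- move=> w hw; rewrite -[l w]/(l w : R) lE big_seq big1 // => f ff.
  rewrite big_seq_cond big1 // => u /andP[uf _]; apply/eqP; rewrite subr_eq0.
  by apply/eqP/(hw f) => //; apply: (hm f (supp_neq0 _ _ uf)).1.
apply/seteqP; split=> w [hw1 hw2]; split=> //=.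
  rewrite -[l w]/(l w : R) lE big_seq big1 // => f ff.
  rewrite big_seq_cond big1 // => u /andP[uf /asboolP hu]; apply/eqP; rewrite subr_eq0.
  apply/eqP/(attains_min_same (hw2 f ff u hu)).
  exact: hw1 f ff _ (hm f (supp_neq0 _ _ uf)).
move=> f ff u hu; have uf := hu.1.
have hmw := hw1 f ff _ (hm f (supp_neq0 _ _ uf)).
apply/(attains_minE hmw) => //; apply/eqP; rewrite -subr_eq0.
move: hw2; rewrite /= -[l w]/(l w : R) lE => /eqP.
rewrite big_seq psumr_eq0; last first.
  move=> g gf; rewrite big_seq_cond sumr_ge0 // => u' /andP[u'f _]; exact: term_ge0.
move=> /allP/(_ f ff); rewrite ff /= big_seq_cond psumr_eq0; last first.
  by move=> u' /andP[u'f _]; apply: term_ge0.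
by move=> /allP/(_ u uf); rewrite uf /= (asboolT hu).
Qed.

Lemma fan_cone_polyhedral v : exists2 s : seq 'Hom(V, R^o),
    fan_cone v = [set w | forall l, l \in s -> 0 <= (l w : R)] &
    forall l w, l \in s -> (forall f, f \in fs -> forall u u', u \in msupp f -> u' \in msupp f ->
           trop_monomial u w = trop_monomial u' w) -> l w = 0.
Proof.
exists (flatten [seq [seq trop_form p.1 - trop_form p.2 |
    p <- [seq (u', u) | u' <- msupp f, u <- [seq u <- msupp f | `[<attains_min f v u>]]]] | f <-
      fs]).
  apply/seteqP; split=> [w hw l /flatten_mapP[f ff /mapP[p /allpairsP[[u' u] [/= u'f]]]]|w h f ff
    u hu].
    rewrite mem_filter => /andP[/asboolP hu uf -> ->] /=.
    rewrite trop_formB subr_ge0.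
    exact: (hw f ff u hu).2.
  split; first exact: hu.1.
  move=> u' u'f; rewrite -subr_ge0 -trop_formB; apply: h.
  apply/flatten_mapP; exists f => //; apply/mapP; exists (u', u) => //.
  by apply/allpairsP; exists (u', u); split=> //=; rewrite mem_filter (asboolT hu) hu.1.
move=> l w /flatten_mapP[f ff /mapP[p /allpairsP[[u' u] [/= u'f]]]].
rewrite mem_filter => /andP[_ uf -> ->] h /=.
by rewrite trop_formB (h f ff u' u) // subrr.
Qed.

(** Two monomials make 0 a point of the prevariety, so a stable subspace consists of points [v] with
    [v] and [- v] in it. Among at most three monomials, the two minimizers at [v] and the two at
    [- v] must share one; it is both minimal and maximal at [v], so all monomials agree there. *)
Lemma lineality_exists :
  (forall f, f \in fs -> f != 0 -> (1 < size (msupp f) <= 3)%N) ->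
  exists2 L : {vspace V}, is_lineality_space trop_prevariety L &
    forall w, w \in L <-> (forall f, f \in fs -> forall u u', u \in msupp f -> u' \in msupp f ->
           trop_monomial u w = trop_monomial u' w).
Proof.
move=> size_f.
pose s := flatten [seq [seq trop_form p.1 - trop_form p.2 |
    p <- [seq (u', u) | u' <- msupp f, u <- msupp f]] | f <- fs].
pose L : {vspace V} := foldr (fun (l : 'Hom(V, R^o)) U => (lker l :&: U)%VS) fullv s.
have LP w : w \in L <-> (forall f, f \in fs -> forall u u', u \in msupp f -> u' \in msupp f ->
           trop_monomial u w = trop_monomial u' w).
  have -> : w \in L = all (fun l : 'Hom(V, R^o) => l w == 0) s.
    by rewrite /L; elim: (s) => [|l s' IH] /=; rewrite ?memvf // memv_cap memv_ker IH.
  split=> [/allP h f ff u u' uf u'f|h].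
    have := h (trop_form u - trop_form u');
      rewrite -[_ == 0]/((_ : R) == 0) trop_formB subr_eq0 => /(_ _)/eqP; apply.
    apply/flatten_mapP; exists f => //; apply/mapP; exists (u, u') => //.
    by apply/allpairsP; exists (u, u').
  apply/allP => l /flatten_mapP[f ff /mapP[p /allpairsP[[u' u] [/= u'f uf -> ->]]]] /=.
  by rewrite trop_formB subr_eq0 (h f ff u' u).
exists L => //; split.
  move=> w v hw /LP hv f ff; case: (hw f ff) => [->|[u1 [u2 [n h1 h2]]]]; first by left.
  have shift u : attains_min f w u -> attains_min f (w + v) u.
    move=> [uf hu]; split=> // u' u'f; rewrite !trop_monomialD (hv f ff u u') //.
    by rewrite lerD2r; apply: hu.
  by right; exists u1, u2; split=> //; apply: shift.
have dr0 : trop_prevariety 0.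
  move=> f ff; case: (eqVneq f 0) => [->|f0]; [by left|right].
  have := size_f f ff f0; have := msupp_uniq f.
  have := @attains_min0 f; case: (msupp f) => [|u1 [|u2 s']] //= h0 /andP[].
  rewrite inE negb_or => /andP[n _] _ _; exists u1, u2; split=> //; apply: h0;
    by rewrite !inE eqxx ?orbT.
move=> L' hL'; apply/subvP => v vL'; apply/LP => f ff u u' uf u'f.
have f0 : f != 0 by apply/eqP => f0; move: uf; rewrite f0 msupp0.
have hv : trop_prevariety v by rewrite -[v]add0r; apply: hL'.
have hNv : trop_prevariety (- v) by rewrite -[- v]add0r; apply: hL' => //; rewrite memvN.
case: (hv f ff) => [e|[u1 [u2 [n12 h1 h2]]]]; first by rewrite e eqxx in f0.
case: (hNv f ff) => [e|[u3 [u4 [n34 h3 h4]]]]; first by rewrite e eqxx in f0.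
have [x [hx hx']] : exists x, attains_min f v x /\ attains_min f (- v) x.
  have /andP[_ sz] := size_f f ff f0.
  case: (eqVneq u1 u3) => [e|n13]; first by exists u1; split=> //; rewrite e.
  case: (eqVneq u1 u4) => [e|n14]; first by exists u1; split=> //; rewrite e.
  case: (eqVneq u2 u3) => [e|n23]; first by exists u2; split=> //; rewrite e.
  case: (eqVneq u2 u4) => [e|n24]; first by exists u2; split=> //; rewrite e.
  have : (size [:: u1; u2; u3; u4] <= size (msupp f))%N.
    apply: uniq_leq_size; first by rewrite /= !inE !negb_or n12 n13 n14 n23 n24 n34.
    by move=> x; rewrite !inE => /or4P[] /eqP ->; [apply: h1.1|apply: h2.1|apply: h3.1|apply: h4.1].
  by rewrite leqNgt ltnS sz.
have ev y : y \in msupp f -> trop_monomial y v = trop_monomial x v.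
  move=> yf; apply/eqP; rewrite eq_le hx.2 // andbT.
  by have := hx'.2 _ yf; rewrite !trop_monomialN lerN2.
by rewrite !ev.
Qed.

End TropicalFan.

End TropicalFans.

(** * Spherical sections *)

Section SphericalSections.
Local Open Scope ring_scope.
Local Open Scope classical_set_scope.
Local Open Scope card_scope.

Section SphericalSection.
Variables (R : realType) (B : finType) (fs : seq {mpoly int[#|B|]}).
Local Notation V := {ffun B -> R^o}.
Variable L : {vspace V}.
Hypothesis LP : forall w, w \in L <->
  (forall f, f \in fs -> forall u u', u \in msupp f -> u' \in msupp f ->
     trop_monomial u w = trop_monomial u' w).
Variables (W : vectType R) (proj : 'Hom(V, W)) (dot : {dot W for @idfun R}) (r : R).
Hypotheses (ker_proj : lker proj = L) (im_proj : limg proj = fullv) (r0 : 0 < r).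
Implicit Types (v w : V) (x y : W).

Local Notation min_le := (@min_le R B fs).
Local Notation fan_cone := (@fan_cone R B fs).
Local Notation prevariety := (@trop_prevariety R B fs).

Definition cell v : set W := (proj @` fan_cone v) `&` sphere dot r.

Lemma proj_eq0 w : proj w = 0 <-> w \in L.
Proof. by rewrite -ker_proj memv_ker; split=> [->|/eqP]. Qed.

Lemma proj_section x : proj (proj^-1%VF x) = x.
Proof. by rewrite limg_lfunVK // im_proj memvf. Qed.

Lemma min_leD_lineality v w u : u \in L -> min_le v w -> min_le v (w + u).
Proof.
move=> /LP hu h f ff m hm; have [mf hmin] := h f ff m hm; split=> // m' m'f.
by rewrite !trop_monomialD (hu f ff m m') // lerD2r hmin.
Qed.

Lemma mem_proj_cone v w : (proj @` fan_cone v) (proj w) <-> min_le v w.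
Proof.
split=> [[w' hw' e]|h]; last by exists w.
have -> : w = w' + (w - w') by rewrite addrC subrK.
by apply: min_leD_lineality => //; apply/proj_eq0; rewrite linearB /= e subrr.
Qed.

Lemma mem_proj_coneV v x : (proj @` fan_cone v) x <-> min_le v (proj^-1%VF x).
Proof. by rewrite -{1}[x]proj_section mem_proj_cone. Qed.

Lemma min_le_opp_lineality v w : min_le v w -> min_le v (- w) -> w \in L.
Proof.
move=> h h'; apply/LP => f ff u u' uf u'f.
have f0 : f != 0 by apply/eqP => f0; move: uf; rewrite f0 msupp0.
have [m hm] := exists_attains_min v f0.
have e (y : 'X_{1..#|B|}) : y \in msupp f -> trop_monomial y w = trop_monomial m w.
  move=> yf; apply/eqP; rewrite eq_le (h f ff m hm).2 // andbT.
  by have := (h' f ff m hm).2 _ yf; rewrite !trop_monomialN lerN2.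
by rewrite !e.
Qed.

Lemma min_le_lineality v w : v \in L -> min_le v w -> w \in L.
Proof.
move=> /LP hv h; apply/LP => f ff u u' uf u'f.
by apply: (@attains_min_same _ _ f); apply: h => //; split=> // m mf; rewrite (hv f ff _ m).
Qed.

Lemma sphere_scaling x : x != 0 -> exists2 a : R, 0 < a & sphere dot r (a *: x).
Proof.
move=> x0; have d0 : 0 < dot x x by apply: neq0_dnorm_gt0.
exists (r / Num.sqrt (dot x x)); first by rewrite divr_gt0 // sqrtr_gt0.
rewrite /sphere /= linearZl_LR linearZ /= mulrA -expr2 exprMn exprVn sqr_sqrtr ?ltW //.
by rewrite divfK // gt_eqF.
Qed.

Lemma sphere_neq0 x : sphere dot r x -> x != 0.
Proof.
rewrite /sphere /=; case: eqP => // ->; rewrite linear0l => /esym/eqP.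
by rewrite sqrf_eq0 gt_eqF.
Qed.

Lemma cell_scaling v w : min_le v w -> w \notin L ->
  exists2 a : R, 0 < a & cell v (proj (a *: w)).
Proof.
move=> h wL; have pw0 : proj w != 0 by apply/eqP => /proj_eq0; apply/negP.
have [a a0 ha] := sphere_scaling pw0; exists a => //; split.
  by apply/mem_proj_cone; apply: min_leZ => //; apply: ltW.
by rewrite linearZ.
Qed.

Lemma mem_cell v x : cell v x <-> min_le v (proj^-1%VF x) /\ sphere dot r x.
Proof. by split=> -[h1 h2]; split=> //; apply/mem_proj_coneV. Qed.

Lemma cell_nonempty v : cell v !=set0 <-> v \notin L.
Proof.
split=> [[x [/mem_proj_coneV h hx]]|vL].
  apply/negP => vL; have := min_le_lineality vL h; move/proj_eq0.
  by rewrite proj_section => e; have := sphere_neq0 hx; rewrite e eqxx.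
by have [a _ h] := cell_scaling (@min_le_refl _ _ fs v) vL; exists (proj (a *: v)).
Qed.

Lemma cell_sub v v' : v' \notin L -> (cell v' `<=` cell v) -> min_le v v'.
Proof.
move=> v'L sub; have [a a0 h] := cell_scaling (@min_le_refl _ _ fs v') v'L.
have [/mem_proj_cone h' _] := sub _ h.
rewrite -[v']scale1r -(mulVf (lt0r_neq0 a0)) -scalerA.
by apply: min_leZ => //; rewrite invr_ge0 ltW.
Qed.

Lemma cell_eqP v v' : v \notin L -> v' \notin L ->
  cell v = cell v' <-> min_le v v' /\ min_le v' v.
Proof.
move=> vL v'L; split=> [e|[h h']].
  by split; apply: cell_sub => //; rewrite e.
by apply/seteqP; split=> x /mem_cell[hx sx]; apply/mem_cell; split=> //;
  [apply: min_le_trans h' hx|apply: min_le_trans h hx].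
Qed.

Let K := spherical_section dot r proj [set C | exists2 v, prevariety v & C = fan_cone v].

Lemma spherical_sectionP D : K D <-> exists v, [/\ prevariety v, v \notin L & D = cell v].
Proof.
split=> [[ne [C [v hv ->] e]]|[v [hv vL ->]]].
  by exists v; split=> //; apply/cell_nonempty; rewrite /cell -e.
by split; [apply/cell_nonempty|exists (fan_cone v) => //; exists v].
Qed.

(** The inequalities are pulled back along the section [proj^-1], which is harmless because cones
    are invariant under [L]. The image is pointed because a vector lying in a cone together with its
    opposite lies in [L]. *)
Lemma cell_polytope v : spherical_polytope dot r (cell v).
Proof.
exists (proj @` fan_cone v); split=> //.
  have [s es sL] := fan_cone_polyhedral fs v.
  exists [seq (l \o proj^-1)%VF | l <- s]; apply/seteqP; split=> x.
    move=> /mem_proj_coneV h l /mapP[l' l's ->]; rewrite comp_lfunE.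
    by move: h; rewrite -[min_le _ _]/(fan_cone v (proj^-1%VF x)) es; apply.
  move=> h; apply/mem_proj_coneV; rewrite -[min_le _ _]/(fan_cone v (proj^-1%VF x)) es => l ls.
  by have := h (l \o proj^-1)%VF; rewrite comp_lfunE; apply; apply: map_f.
move=> x /mem_proj_coneV h h'.
have : proj^-1%VF x \in L.
  apply: (min_le_opp_lineality h); move/mem_proj_coneV: h'; by rewrite linearN.
by move/proj_eq0; rewrite proj_section.
Qed.

Lemma cell_faces v F : prevariety v -> v \notin L -> is_face F (cell v) -> F !=set0 -> K F.
Proof.
move=> hv vL [l [l0 eF]] F0.
have lc w : fan_cone v w -> 0 <= ((l \o proj)%VF w : R).
  move=> hw; rewrite comp_lfunE; case: (boolP (w \in L)) => [/proj_eq0 ->|wL].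
    by rewrite linear0.
  have [a a0 /l0] := cell_scaling hw wL.
  by rewrite !linearZ /= -[X in 0 <= X]/(a * _) pmulr_rge0.
have [v' [vv' _ e]] := fan_cone_face lc.
have eF' : F = cell v'.
  rewrite eF; apply/seteqP; split=> x.
    move=> [/mem_cell[hx sx] lx]; apply/mem_cell; split=> //.
    rewrite -[min_le _ _]/(fan_cone v' _) -e; split=> //=.
    by rewrite comp_lfunE proj_section.
  move=> /mem_cell[]; rewrite -[min_le _ _]/(fan_cone v' _) -e => -[hx /= lx] sx.
  split; first exact/mem_cell.
  by move: lx; rewrite comp_lfunE proj_section.
apply/spherical_sectionP; exists v'; split=> //.
  exact: min_le_prevariety hv.
by apply/cell_nonempty; rewrite -eF'.
Qed.

Lemma cell_meet_face v1 v2 : is_face (cell v1 `&` cell v2) (cell v1).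
Proof.
have [l [l0 lL e]] := fan_cone_meet fs v1 v2.
have lE x : (l \o proj^-1)%VF x = l (proj^-1%VF x) by rewrite comp_lfunE.
exists (l \o proj^-1)%VF; split=> [x /mem_cell[hx _]|].
  by rewrite lE; apply: l0.
apply/seteqP; split=> x.
  move=> [/mem_cell[h1 sx] /mem_cell[h2 _]]; split; first exact/mem_cell.
  rewrite /= lE.
  have : (fan_cone v1 `&` fan_cone v2) (proj^-1%VF x) by [].
  by rewrite e => -[].
move=> [/mem_cell[h1 sx] lx]; split; apply/mem_cell; split=> //.
have : (fan_cone v1 `&` [set w | l w = 0]) (proj^-1%VF x).
  by split=> //=; rewrite -lE.
by rewrite -e => -[].
Qed.

Lemma section_is_complex : finite_set K -> spherical_complex dot r K.
Proof.
move=> fin; split=> //.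
- move=> D /spherical_sectionP[v [hv vL ->]]; split; first exact: cell_polytope.
  exact/cell_nonempty.
- by move=> D F /spherical_sectionP[v [hv vL ->]]; apply: cell_faces.
- move=> D1 D2 /spherical_sectionP[v1 [_ _ ->]] /spherical_sectionP[v2 [_ _ ->]] _.
  by split; [|rewrite setIC]; apply: cell_meet_face.
Qed.

Lemma is_linear_span_unique (D : set W) (U U' : {vspace W}) :
  is_linear_span D U -> is_linear_span D U' -> U = U'.
Proof.
move=> [h1 h2] [h1' h2']; apply/eqP; rewrite eqEsubv h2 ?h2' //.
Qed.

(** It is enough that [Y] spans the cone modulo [L], which [proj] kills; and each member of [Y]
    outside [L] reaches the sphere after rescaling, so the span of the cell contains its image. *)
Lemma cell_linear_span v (Y : seq V) : (forall y : V, y \in Y -> min_le v y) ->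
  (forall w, min_le v w -> exists2 u, u \in L & w - u \in <<Y>>%VS) ->
  is_linear_span (cell v) (proj @: <<Y>>)%VS.
Proof.
move=> hY hspan; split=> [x [[w hw <-] _]|U hU].
  have [u uL hu] := hspan w hw.
  have -> : proj w = proj (w - u) by rewrite linearB /= (proj_eq0 u).2 // subr0.
  exact: memv_img.
rewrite limg_span; apply/span_subvP => y /mapP[y' /hY h ->].
case: (boolP (y' \in L)) => [/proj_eq0 ->|yL]; first exact: mem0v.
have [a a0 /hU] := cell_scaling h yL.
rewrite linearZ /= => h'; rewrite -[proj y']scale1r -(mulVf (lt0r_neq0 a0)) -scalerA.
exact: memvZ.
Qed.

Lemma cell_dimP v (Y : seq V) i : (forall y : V, y \in Y -> min_le v y) ->
  (forall w, min_le v w -> exists2 u, u \in L & w - u \in <<Y>>%VS) ->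
  cell_dim (cell v) i <-> \dim (proj @: <<Y>>) = i.+1.
Proof.
move=> hY hspan; have hU := cell_linear_span hY hspan; split=> [[U hU' <-]|e].
  by rewrite (is_linear_span_unique hU hU').
by exists (proj @: <<Y>>)%VS.
Qed.

End SphericalSection.

End SphericalSections.

(** * The fifteen-dimensional model *)

Section Computation.

(* [nth [::] stars v] lists the points that are edges of K5 at the vertex v. *)
Definition stars : seq (seq nat) :=
  [:: [:: 0; 2; 3; 5]; [:: 0; 6; 7; 8]; [:: 1; 3; 4; 6]; [:: 1; 5; 8; 9]; [:: 2; 4; 7; 9]].

Definition star_deg (l : seq nat) (v : nat) : nat := count (mem (nth [::] stars v)) l.

(* Variable v < 5 stands for h_v, and variable 5 + p for the form h_i + h_j where p
   is the edge {i, j}.  A basis is in K5 a star at v, a path with inner vertices v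
   and w, or a path of length two centred at v with a disjoint edge p; its
   determinant is h_v^2, h_v h_w or h_v (h_i + h_j). *)
Definition weight (l : seq nat) : seq nat :=
  let s := [seq v <- iota 0 5 | 1 < star_deg l v] in
  if s is [:: v] then
    v :: (if [seq p <- l | p \notin nth [::] stars v] is p :: _ then [:: 5 + p] else [:: v])
  else s.

Definition is_key (l : seq nat) : bool := l \notin desargues_lines.

Definition sort3 (a b c : nat) : seq nat := sort leq [:: a; b; c].

Definition relation := (nat * nat * nat * nat * nat)%type.

Definition monomials (q : relation) : seq (seq nat * seq nat) :=
  let: (s, i, j, k, l) := q in
  [seq m <- [:: (sort3 s i j, sort3 s k l); (sort3 s i k, sort3 s j l); (sort3 s i l, sort3 s j k)]
  | is_key m.1 && is_key m.2].

Definition exponents (q : relation) : seq (seq nat) :=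
  [seq weight m.1 ++ weight m.2 | m <- monomials q].

Fixpoint multiset_inter (a b : seq nat) : seq nat :=
  if a is x :: a' then if x \in b then x :: multiset_inter a' (rem x b) else multiset_inter a' b
  else [::].

Definition multiset_diff (a c : seq nat) : seq nat := foldl (fun e x => rem x e) a c.

(** Division by the greatest common monomial shifts all values by the same amount and so keeps the
    minimizers. Sorting gives equal monomials equal lists, as the comparison with [trinomials] in
    [classified] needs. *)
Definition reduced (es : seq (seq nat)) : seq (seq nat) :=
  if es is e :: es' then
    let c := foldr multiset_inter e es' in [seq sort leq (multiset_diff e c) | e <- es]
  else [::].

(* One three-term relation for each trinomial, those of degree one first. *)
Definition representatives : seq relation :=
  [:: (0,1,2,3,4); (0,1,2,3,5); (0,1,3,4,5); (0,1,3,4,9); (0,1,3,5,9); (0,1,4,5,9); (1,0,2,3,6);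
    (1,0,2,3,7); (1,0,2,4,7); (1,0,2,6,7); (1,0,3,6,7); (2,0,3,5,6); (2,0,3,5,8); (2,0,3,6,8);
    (2,0,5,6,8); (3,0,1,7,8); (3,0,1,8,9); (3,0,2,7,8); (4,0,2,5,6); (4,0,2,6,8); (4,0,5,6,8);
    (5,0,1,6,7); (5,0,2,6,7); (6,0,1,5,9); (7,0,3,4,8); (0,1,2,3,9); (0,1,2,4,5); (0,3,4,5,9);
    (1,0,2,4,6); (1,0,3,4,7); (1,2,3,6,7); (2,0,1,3,8); (2,0,1,5,6); (2,3,5,6,8); (3,0,1,7,9);
    (3,0,2,8,9); (3,1,2,7,8); (4,0,1,2,8); (4,0,1,5,6); (4,2,5,6,8); (5,0,1,4,7); (5,0,2,4,6);
    (5,1,2,6,7); (6,0,1,2,9); (6,0,4,5,9); (6,1,2,4,5); (7,0,1,3,8); (7,0,1,4,5); (7,3,4,5,8);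
    (8,0,1,2,4); (8,0,3,4,7); (8,1,2,3,7); (9,0,1,2,6); (9,0,1,3,7); (9,2,3,6,7)].

Definition trinomials : seq (seq (seq nat)) :=
  [seq reduced (exponents q) | q <- representatives].

Definition dotn (m g : seq nat) : nat := sumn [seq nth 0 g i | i <- m].

Definition minimizer_bits (t : seq (seq nat)) (g : seq nat) : seq bool :=
  let v := [seq dotn m g | m <- t] in [seq all (leq a) v | a <- v].

(* Generators are taken modulo the all-one vector. *)
Definition add_generators (g h : seq nat) : seq nat :=
  let s := [seq nth 0 g i + nth 0 h i | i <- iota 0 15] in
  let k := foldr minn (head 0 s) s in [seq a - k | a <- s].

(* Nested [if]s: call-by-value evaluation would compute both sides of [&&]. *)
Fixpoint eq_gen (s t : seq nat) : bool :=
  match s, t with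
  | [::], [::] => true
  | x :: s', y :: t' => if eqn x y then eq_gen s' t' else false
  | _, _ => false
  end.

Fixpoint mem_gen (H : seq (seq nat)) (g : seq nat) : bool :=
  if H is h :: H' then if eq_gen h g then true else mem_gen H' g else false.

Fixpoint sub_gen (G H : seq (seq nat)) : bool :=
  if G is g :: G' then if mem_gen H g then sub_gen G' H else false else true.

Fixpoint undup_gen (G : seq (seq nat)) : seq (seq nat) :=
  if G is g :: G' then let H := undup_gen G' in if mem_gen H g then H else g :: H else [::].

Fixpoint insub_any (Q : seq (seq (seq nat))) G : bool :=
  if Q is H :: Q' then if sub_gen G H then true else insub_any Q' G else false.

Definition prune (Q : seq (seq (seq nat))) : seq (seq (seq nat)) :=
  foldr (fun G acc => if insub_any acc G then acc
     else G :: [seq H <- acc | ~~ sub_gen H G]) [::] Q.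

(** The pair sharing the fewest minimal monomials is split first, ties going to the larger
    coordinate sum. Soundness does not depend on this choice, since [cone_split] holds for every
    pair. *)
Definition pair_key (a b : seq nat * seq bool) : nat * nat :=
  (count id [seq p.1 && p.2 | p <- zip a.2 b.2], sumn a.1 + sumn b.1).

Definition better (x y : nat * nat) : bool :=
  (x.1 < y.1) || ((x.1 == y.1) && (y.2 < x.2)).

Fixpoint all_pairs (s : seq (seq nat * seq bool)) :=
  if s is a :: s' then [seq (a, b) | b <- s'] ++ all_pairs s' else [::].

Definition best_pair (s : seq (seq nat * seq bool)) : option (seq nat * seq nat) :=
  omap (fun x => (x.1.1.1, x.1.2.1))
  (foldl (fun (acc : option ((seq nat * seq bool) * (seq nat * seq bool) * (nat * nat))) p =>
     let k := pair_key p.1 p.2 in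
     if acc is Some (_, k') then if better k k' then Some (p, k) else acc else Some (p, k))
    None (all_pairs s)).

(* If a monomial is minimal on all generators, another one must be minimal at the
   points of the cone that satisfy the trinomial.  Otherwise, subdivide along the
   sum of two generators. *)
Fixpoint refine (fuel : nat) (t : seq (seq nat)) (G : seq (seq nat)) : seq (seq (seq nat)) :=
  let B := [seq (g, minimizer_bits t g) | g <- G] in
  if [seq k <- iota 0 (size t) | all (fun b => nth false b.2 k) B] is k :: _ then
    [seq [seq b.1 | b <- B & nth false b.2 j] | j <- iota 0 (size t) & j != k]
  else if fuel is n.+1 then
    if best_pair B is Some (g, h) then
      let s := add_generators g h in
      let G0 := rem h (rem g G) in
      refine n t (s :: g :: G0) ++ refine n t (s :: h :: G0)
    else [:: G]
  else [:: G].

Definition nonzero (G : seq (seq nat)) := [seq g <- G | has (fun a => a != 0) g].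

Definition refine_all (t : seq (seq nat)) (Q : seq (seq (seq nat))) :=
  flatten [seq prune [seq nonzero H | H <- refine 40 t G] | G <- Q].

Definition unit_generators := [seq [seq (i == j : nat) | j <- iota 0 15] | i <- iota 0 15].

(* Pruning at these stages and preferring large generators in [best_pair] are
   heuristics that only keep the list short. *)
Definition pieces : seq (seq (seq nat)) :=
  foldl (fun Q p => let Q' := refine_all p.2 Q in
       if p.1 \in [:: 3; 9; 15; 19; 24] then prune Q' else Q')
   [:: unit_generators] (zip (iota 0 25) trinomials).

Definition bits (g : seq nat) : seq bool := flatten [seq minimizer_bits t g | t <- trinomials].

Definition meet_bits (a b : seq bool) : seq bool := [seq p.1 && p.2 | p <- zip a b].

Fixpoint bits_le (a b : seq bool) : bool :=
  match a, b with
  | x :: a', y :: b' => if (if x then y else true) then bits_le a' b' else false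
  | _, _ => true
  end.

(* Pairwise comparison of the signatures would be too slow. *)
Fixpoint radix_undup (n : nat) (L : seq (seq bool)) : seq (seq bool) :=
  if L is [::] then [::] else
  if n is m.+1 then
    map (cons true) (radix_undup m [seq behead l | l <- L & head false l]) ++
    map (cons false) (radix_undup m [seq behead l | l <- L & ~~ head false l])
  else [:: [::]].

Fixpoint attained_twice (s : seq bool) : bool :=
  if s is a :: b :: c :: s' then (1 < a + b + c) && attained_twice s' else true.

Definition full_bits : seq bool := nseq 165 true.

(** One meet per subset of the generators. The empty subset gives [full_bits], the signature of the
    lineality space. *)
Definition face_bits (G : seq (seq nat)) : seq (seq bool) :=
  foldr (fun g acc => let b := bits g in acc ++ map (meet_bits b) acc) [:: full_bits] G.

(** The representative with first coordinate 0 modulo the all-one vector, so that ranks are computed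
    in the quotient. *)
Definition shifted (g : seq nat) : seq int := [seq (a%:Z - (head 0 g)%:Z)%R | a <- g].

(* A row is stored with the index of its pivot. *)
Fixpoint echelon_reduce (E : seq (nat * seq int)) (r : seq int) : seq int :=
  if E is (p, e) :: E' then
    let a := nth 0%R e p in let b := nth 0%R r p in
    echelon_reduce E' (if b == 0%R then r else [seq (a * x.2 - b * x.1)%R | x <- zip e r])
  else r.

Definition echelon_insert (E : seq (nat * seq int)) (r : seq int) : seq (nat * seq int) :=
  let r' := echelon_reduce E r in
  let p := find (fun a => a != 0%R) r' in
  if p < size r' then rcons E (p, r') else E.

Definition echelon (L : seq (seq int)) := foldl echelon_insert [::] L.

Definition dimension (A : seq (seq bool * seq int)) (s : seq bool) : nat :=
  size (echelon [seq a.2 | a <- A & bits_le s a.1]).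

Definition signatures P := radix_undup 165 (flatten [seq face_bits G | G <- P]).

Definition generators (P : seq (seq (seq nat))) := undup_gen (flatten P).

Definition table P := [seq (bits g, shifted g) | g <- generators P].

(** The second conjunct says that no generator lies in the lineality space. The third puts every
    face of every piece inside the Dressian and supplies the hypothesis of [signatureD]. Counting
    starts at dimension 1 because a cone of dimension k modulo lineality gives a cell of dimension k
    - 1. *)
Definition certificate (P : seq (seq (seq nat))) : bool :=
  let A := table P in
  let S := signatures P in
  let D := [seq dimension A s | s <- S] in
  [&& all (fun g => size g == 15) (generators P), all (fun a => ~~ all id a.1) A,
      all attained_twice S, all (leq^~ 4) D
    & [seq count (pred1 k) D | k <- iota 1 4] == [:: 70; 370; 510; 150]].

Lemma pieces_certificate : certificate pieces.
Proof. by vm_compute. Qed.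

End Computation.

(** * Soundness of the cover *)

Section Cover.
Local Open Scope ring_scope.

Lemma eq_genP s t : eq_gen s t = (s == t).
Proof.
elim: s t => [|a s IH] [|b t] //=; rewrite eqseq_cons -IH.
by rewrite -[eqn a b]/(a == b); case: (a == b).
Qed.

Lemma mem_genP H g : mem_gen H g = (g \in H).
Proof. by elim: H => //= h H ->; rewrite eq_genP inE eq_sym; case: (g == h). Qed.

Lemma sub_genP G H : reflect {subset G <= H} (sub_gen G H).
Proof.
have -> : sub_gen G H = all (mem H) G by elim: G => //= g G ->; rewrite mem_genP; case: (g \in H).
exact: allP.
Qed.

Lemma mem_undup_gen G : undup_gen G =i G.
Proof.
elim: G => //= g G IH h; rewrite mem_genP; case: ifP => gG; rewrite !inE IH //.
by case: eqP => // ->; rewrite -IH gG.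
Qed.

Lemma pruneP Q G : G \in Q -> exists2 H, H \in prune Q & {subset G <= H}.
Proof.
elim: Q => //= G' Q IH; rewrite inE.
have any : insub_any (prune Q) G' -> exists2 H, H \in prune Q & {subset G' <= H}.
  elim: (prune Q) => //= H Q' IH'; case: (sub_genP G' H) => [h _|_ /IH'[H' h1 h2]].
    by exists H => //; rewrite mem_head.
  by exists H' => //; rewrite inE h1 orbT.
case: ifP => [/any[H HQ sub]|_] /orP[/eqP ->|/IH[H' H'Q sub']].
- by exists H.
- by exists H'.
- by exists G' => //; rewrite mem_head.
case: (boolP (sub_gen H' G')) => [/sub_genP s|s].
  by exists G'; rewrite ?mem_head // => x /sub' /s.
by exists H' => //; rewrite inE mem_filter s H'Q orbT.
Qed.

Local Arguments iota : simpl never.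

Section Model.
Variable R : realType.
Local Notation X := {ffun 'I_15 -> R^o}.
Implicit Types (x y : X) (g h m : seq nat) (t G : seq (seq nat)) (l : R).

Definition vec g : X := [ffun i : 'I_15 => (nth 0 g i)%:R].
Definition one_vec : X := [ffun => 1].
Definition mdot m x : R := \sum_(i <- m) x (inord i).
Definition minimal t x m : bool := all (fun m' => mdot m x <= mdot m' x) t.
Definition real_minimizer_bits t x : seq bool := [seq minimal t x m | m <- t].
Definition signature (ts : seq (seq (seq nat))) x : seq bool :=
  flatten [seq real_minimizer_bits t x | t <- ts].

(** The cone spanned by [G] and the line of the all-one vector, in recursive form so that proofs
    peel off one generator at a time. Repeated or dependent generators are allowed. *)
Fixpoint cone G x : Prop :=
  if G is g :: G' then exists2 l, 0 <= l & cone G' (x - l *: vec g)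
  else exists l, x = l *: one_vec.

Lemma mdotD m x y : mdot m (x + y) = mdot m x + mdot m y.
Proof. by rewrite /mdot -big_split; apply: eq_bigr => i _; rewrite ffunE. Qed.

Lemma mdotZ m l x : mdot m (l *: x) = l * mdot m x.
Proof. by rewrite /mdot mulr_sumr; apply: eq_bigr => i _; rewrite ffunE. Qed.

Lemma mdotB m x y : mdot m (x - y) = mdot m x - mdot m y.
Proof. by rewrite -scaleN1r mdotD mdotZ mulN1r. Qed.

Lemma mdot_one m : mdot m one_vec = (size m)%:R.
Proof.
by rewrite /mdot (eq_bigr (fun=> 1)) ?big_const_seq ?count_predT ?iter_addr_0 // => i _;
  rewrite ffunE.
Qed.

Lemma mdot_vec m g : all (ltn^~ 15) m -> mdot m (vec g) = (dotn m g)%:R.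
Proof.
rewrite /mdot /dotn; elim: m => [|i m IH] /=; first by rewrite big_nil.
by move=> /andP[i15 /IH]; rewrite big_cons natrD ffunE => ->; rewrite inordK.
Qed.

Lemma mdot_cat m m' x : mdot (m ++ m') x = mdot m x + mdot m' x.
Proof. exact: big_cat. Qed.

Lemma mdot_perm m m' x : perm_eq m m' -> mdot m x = mdot m' x.
Proof. exact: perm_big. Qed.

Definition wf_trinomial t : bool :=
  [&& size t == 3, all (fun m => all (ltn^~ 15) m) t &
      all (fun m => size m == size (nth [::] t 0)) t].

Lemma cone_add G h l x : h \in G -> 0 <= l -> cone G (x - l *: vec h) -> cone G x.
Proof.
elim: G x => //= g G IH x; rewrite inE => /orP[/eqP <-|hG] l0 [a a0 hc].
  by exists (l + a); rewrite ?addr_ge0 // scalerDl opprD addrA.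
by exists a => //; apply: IH hG l0 _; rewrite addrAC.
Qed.

Lemma cone_subset G H x : {subset G <= H} -> cone G x -> cone H x.
Proof.
elim: G x => [|g G IH] x sub /=.
  move=> [l ->]; elim: H {sub} => [|h H IH] /=; first by exists l.
  by exists 0 => //; rewrite scale0r subr0.
move=> [l l0 /IH hc]; apply: (@cone_add _ g l) => //; first by apply: sub; rewrite mem_head.
by apply: hc => h hG; apply: sub; rewrite inE hG orbT.
Qed.

Lemma cone_sum G (a : seq nat -> R) l : (forall g, 0 <= a g) ->
  cone G (l *: one_vec + \sum_(g <- G) a g *: vec g).
Proof.
move=> a0; elim: G => [|g G IH] /=; first by exists l; rewrite big_nil addr0.
by exists (a g) => //; rewrite big_cons addrCA addrAC subrr add0r.
Qed.

Lemma cone_le G m m' x : all (ltn^~ 15) m -> all (ltn^~ 15) m' -> size m = size m' ->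
  all (fun g => dotn m g <= dotn m' g)%N G -> cone G x -> mdot m x <= mdot m' x.
Proof.
move=> hm hm' sz; elim: G x => [|g G IH] x /=.
  by move=> _ [l ->]; rewrite !mdotZ !mdot_one sz.
move=> /andP[le /IH h] [l l0 /h]; rewrite !mdotB !mdotZ !mdot_vec // => h'.
have : l * (dotn m g)%:R <= l * (dotn m' g)%:R by rewrite ler_wpM2l // ler_nat.
by lra.
Qed.

(** The gap between the two monomials is nonnegative on each generator and, the degrees being equal,
    zero on the all-one vector. If it vanishes at a nonnegative combination, every generator with a
    positive gap has coefficient 0. *)
Lemma cone_filter G m m' x : all (ltn^~ 15) m -> all (ltn^~ 15) m' -> size m = size m' ->
  all (fun g => dotn m g <= dotn m' g)%N G -> mdot m x = mdot m' x -> cone G x ->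
  cone [seq g <- G | dotn m g == dotn m' g] x.
Proof.
move=> hm hm' sz; elim: G x => [|g G IH] x //=.
move=> /andP[le hG] e [l l0 hc].
have := cone_le hm hm' sz hG hc; rewrite !mdotB !mdotZ !mdot_vec // => h'.
have h'' : l * (dotn m g)%:R <= l * (dotn m' g)%:R by rewrite ler_wpM2l // ler_nat.
have e2 : l * (dotn m g)%:R = l * (dotn m' g)%:R by move: h' h''; rewrite e; lra.
have hc' : cone [seq g <- G | dotn m g == dotn m' g] (x - l *: vec g).
  by apply: IH => //; rewrite !mdotB !mdotZ !mdot_vec // e e2.
case: eqP => [_|ne] /=; first by exists l.
suff l_eq0 : l = 0 by move: hc'; rewrite l_eq0 scale0r subr0.
apply/eqP; apply/contraT => ln0; move/(mulfI ln0)/eqP: e2.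
by rewrite eqr_nat => /eqP.
Qed.

Lemma cone_rem G g x : g \in G -> cone G x -> cone (g :: rem g G) x.
Proof.
elim: G x => //= a G IH x; rewrite inE eq_sym;
  case: eqP => [-> //|_] /= gG [l l0 /(IH _ gG)[b b0 hc]].
by exists b => //; exists l => //; move: hc; rewrite addrAC.
Qed.

Lemma foldr_minn_le (s : seq nat) a b : a \in s -> (foldr minn b s <= a)%N.
Proof.
elim: s => //= c s IH; rewrite inE => /orP[/eqP ->|/IH h]; first exact: geq_minl.
exact: leq_trans (geq_minr _ _) h.
Qed.

Lemma vec_add_generators g h :
  exists k, vec (add_generators g h) = vec g + vec h - k *: one_vec.
Proof.
rewrite /add_generators; cbv zeta; set s := [seq _ | i <- iota 0 15]; set k := foldr _ _ _.
exists k%:R; apply/ffunP => i; rewrite !ffunE [_%:R *: 1]mulr1.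
have sz : size s = 15 by rewrite size_map size_iota.
have es : nth 0 s i = (nth 0 g i + nth 0 h i)%N.
  by rewrite (nth_map 0) ?size_iota // nth_iota.
rewrite (nth_map 0) ?sz // natrB ?es ?natrD //.
by rewrite -es; apply: foldr_minn_le; rewrite mem_nth ?sz.
Qed.

Lemma cone_one G l x : cone G (x + l *: one_vec) -> cone G x.
Proof.
elim: G x => [|g G IH] x /=.
  by move=> [b e]; exists (b - l); rewrite scalerBl -e addrK.
by move=> [b b0 h]; exists b => //; apply: IH; rewrite addrAC.
Qed.

(** Stellar subdivision: a g + b h is a (g + h) + (b - a) h or b (g + h) + (a - b) g, according to
    which coefficient is smaller. The normalization of g + h is absorbed by the all-one line. *)
Lemma cone_split g h G x : cone [:: g, h & G] x ->
  cone [:: add_generators g h, g & G] x \/ cone [:: add_generators g h, h & G] x.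
Proof.
have [k ek] := vec_add_generators g h.
move=> /= [a a0 [b b0 hc]]; have [ab|ba] := leP a b; [right|left].
  exists a => //; exists (b - a); rewrite ?subr_ge0 //.
  apply: (@cone_one _ (- (a * k))); move: hc; congr cone; rewrite ek.
  by apply/ffunP => i; rewrite !ffunE /GRing.scale /=; ring.
exists b => //; exists (a - b); rewrite ?subr_ge0 ?ltW //.
apply: (@cone_one _ (- (b * k))); move: hc; congr cone; rewrite ek.
by apply/ffunP => i; rewrite !ffunE /GRing.scale /=; ring.
Qed.

Lemma cone_nonzero G x : cone G x -> cone (nonzero G) x.
Proof.
elim: G x => //= g G IH x [l l0 /IH hc]; case: ifP => [_|z]; first by exists l.
suff e : vec g = 0 by move: hc; rewrite e scaler0 subr0.
apply/ffunP => i; rewrite !ffunE; case: (ltnP i (size g)) => [lt|ge].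
  by move/negbT/hasPn/(_ _ (mem_nth 0 lt)): z; rewrite negbK => /eqP ->.
by rewrite nth_default.
Qed.

(** All that soundness asks of the heuristic: it returns two different occurrences in the list of
    generators, so both can be removed and the sum put in their place. *)
Lemma best_pairP B g h : best_pair B = Some (g, h) ->
  g \in [seq b.1 | b <- B] /\ h \in rem g [seq b.1 | b <- B].
Proof.
rewrite /best_pair.
have sub s : forall p, p \in all_pairs s ->
    p.1.1 \in [seq b.1 | b <- s] /\ p.2.1 \in rem p.1.1 [seq b.1 | b <- s].
  elim: s => //= a s IH p; rewrite mem_cat => /orP[/mapP[b bs ->]|/IH[h1 h2]] /=.
    by rewrite mem_head eqxx map_f.
  split; first by rewrite inE h1 orbT.
  by case: eqP => [_|_]; [apply: mem_rem h2|rewrite inE h2 orbT].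
set f := (X in foldl X).
have inv L acc q : (forall p, p \in L -> p \in all_pairs B) ->
    (forall p, acc = Some p -> p.1 \in all_pairs B) -> foldl f acc L = Some q ->
    q.1 \in all_pairs B.
  elim: L acc => [|p L IH] acc hL hacc /=; first exact: hacc.
  apply: IH => [p' p'L|p']; first by apply: hL; rewrite inE p'L orbT.
  have pB : p \in all_pairs B by apply: hL; rewrite mem_head.
  rewrite /f; case: acc hacc => [[p'' k]|] hacc; last by case=> <-.
  by case: ifP => _; [case=> <-|apply: hacc].
case e : (foldl f None _) => [q|] //= -[<- <-]; apply: sub.
by apply: (inv _ _ _ _ _ e).
Qed.

(** A monomial minimal on all generators is minimal on the whole cone; a valid [x] then has a second
    minimal monomial, and [cone_filter] keeps the generators on which the two agree. Otherwise [x]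
    goes to one half of the subdivision. Exhausted fuel is harmless, as [G] itself is returned. *)
Lemma refineP n t G x : wf_trinomial t -> (1 < count id (real_minimizer_bits t x))%N ->
  cone G x -> exists2 H, H \in refine n t G & cone H x.
Proof.
move=> /and3P[/eqP sz t15 tsz] valid.
have nth15 i : (i < size t)%N -> all (ltn^~ 15) (nth [::] t i).
  by move=> lt; apply: (allP t15); apply: mem_nth.
have nthsz i j : (i < size t)%N -> (j < size t)%N -> size (nth [::] t i) = size (nth [::] t j).
  by move=> lti ltj; rewrite (eqP (allP tsz _ (mem_nth _ lti))) (eqP (allP tsz _ (mem_nth _ ltj))).
have minE g k : (k < size t)%N -> nth false (minimizer_bits t g) k =
    all (fun m => dotn (nth [::] t k) g <= dotn m g)%N t.
  by move=> lt; rewrite /minimizer_bits (nth_map 0) ?size_map // (nth_map [::]) // all_map.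
have common (G' : seq (seq nat)) k : (k < size t)%N -> all (fun g => nth false (minimizer_bits t
  g) k) G' ->
    cone G' x -> exists2 H, H \in [seq [seq g <- G' | nth false (minimizer_bits t g) j]
       | j <- iota 0 (size t) & j != k] & cone H x.
  move=> kt hk hc.
  have le_k j : (j < size t)%N -> all (fun g => dotn (nth [::] t k) g <= dotn (nth [::] t j) g)%N
    G'.
    move=> jt; apply/allP => g /(allP hk); rewrite minE // => /allP; apply; exact: mem_nth.
  have [j jt [jk mj]] : exists2 j, (j < size t)%N & j != k /\ minimal t x (nth [::] t j).
    apply/not_exists2P => no; move: valid; rewrite ltnNge => /negP; apply.
    rewrite /real_minimizer_bits count_map.
    have -> : count (preim (minimal t x) id) t = count (minimal t x) t by [].
    rewrite -(mkseq_nth [::] t) count_map -size_filter.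
    apply: (@leq_trans (size [:: k])) => //; apply: uniq_leq_size.
      by rewrite filter_uniq // iota_uniq.
    move=> j; rewrite mem_filter mem_iota /= add0n mkseq_nth inE => /andP[mj jt].
    by apply: contraT => jk; case: (no j) => -[].
  exists [seq g <- G' | nth false (minimizer_bits t g) j].
    by apply: (map_f (fun j => [seq g <- G' | nth false (minimizer_bits t g) j]));
      rewrite mem_filter jk mem_iota.
  have -> : [seq g <- G' | nth false (minimizer_bits t g) j] =
            [seq g <- G' | dotn (nth [::] t k) g == dotn (nth [::] t j) g].
    apply: eq_in_filter => g gG; rewrite minE //; apply/allP/eqP.
      move=> h; apply/eqP; rewrite eqn_leq (allP (le_k j jt) _ gG) h //; exact: mem_nth.
    by move=> <- m mt; move: (allP hk _ gG); rewrite minE // => /allP; apply.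
  apply: cone_filter => //; rewrite ?nth15 //; [exact: nthsz|exact: le_k|].
  apply/eqP; rewrite eq_le (cone_le _ _ _ (le_k j jt)) ?nth15 //; last exact: nthsz.
  by apply: (allP mj); apply: mem_nth.
have mapB (G' : seq (seq nat)) j : [seq b.1 | b <- [seq (g, minimizer_bits t g) | g <- G'] & nth
  false b.2 j] =
    [seq g <- G' | nth false (minimizer_bits t g) j].
  by rewrite filter_map -map_comp map_id.
have step (G' : seq (seq nat)) k s : [seq k <- iota 0 (size t) | all (fun b : seq nat * seq bool
  => nth false b.2 k)
      [seq (g, minimizer_bits t g) | g <- G']] = k :: s -> cone G' x ->
   exists2 H, H \in [seq [seq b.1 | b <- [seq (g, minimizer_bits t g) | g <- G'] & nth false b.2 j]
       | j <- iota 0 (size t) & j != k] & cone H x.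
  move=> e; have : k \in k :: s by rewrite mem_head.
  rewrite -e mem_filter mem_iota /= add0n => /andP[hk kt].
  under eq_map do rewrite mapB.
  by apply: common => //; move: hk; rewrite all_map.
elim: n G => [|n IH] G /=; case e : [seq _ <- _ | _] => [|k s].
- by move=> hc; exists G; rewrite ?mem_head.
- exact: step e.
- case bp : best_pair => [[g h]|] hc; last by exists G; rewrite ?mem_head.
  have [] := best_pairP bp; rewrite -map_comp map_id => gG hG.
  have : cone [:: g, h & rem h (rem g G)] x.
    by have [l l0 /(cone_rem hG)] := cone_rem gG hc; exists l.
  by move=> /cone_split[] /IH[H HH cH]; exists H => //; rewrite mem_cat HH ?orbT.
- exact: step e.
Qed.

Lemma refine_allP t Q x : wf_trinomial t -> (1 < count id (real_minimizer_bits t x))%N ->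
  (exists2 G, G \in Q & cone G x) -> exists2 G, G \in refine_all t Q & cone G x.
Proof.
move=> wf valid [G GQ /(refineP 40 wf valid)[H HG cH]].
have [H' H'G sub] := pruneP (map_f nonzero HG).
exists H'; last exact: cone_subset sub (cone_nonzero cH).
by apply/flatten_mapP; exists G.
Qed.

Lemma pruneP_cone Q x :
  (exists2 G, G \in Q & cone G x) -> exists2 G, G \in prune Q & cone G x.
Proof.
by move=> [G /pruneP[H HQ sub] hc]; exists H => //; apply: cone_subset sub hc.
Qed.

(** With [l] below all coordinates, x is l times the all-one vector plus a nonnegative combination
    of unit vectors. *)
Lemma unit_cone x : cone unit_generators x.
Proof.
have [l hl] : exists l : R, forall i, l <= x i.
  exists (- \sum_i `|x i|) => i; rewrite lerNl (le_trans (ler_norm _)) // normrN.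
  by rewrite (bigD1 i) //= lerDl sumr_ge0.
(* In [cone_sum] the coefficient is a function of the generator; the position of the entry 1
   recovers the index of a unit vector. *)
pose a g : R := if (index 1%N g < 15)%N then x (inord (index 1%N g)) - l else 0.
pose u i := [seq (i == j : nat) | j <- iota 0 15].
have uE i (k : 'I_15) : vec (u i) k = (i == k)%:R :> R.
  by rewrite ffunE (nth_map 0) ?size_iota // nth_iota.
have au (i : 'I_15) : a (u i) = x i - l.
  rewrite /a; suff -> : index 1%N (u i) = i by rewrite ltn_ord inord_val.
  by case: i; do 15?case=> //.
have -> : x = l *: one_vec + \sum_(g <- unit_generators) a g *: vec g.
  rewrite /unit_generators big_map -[iota 0 15]/(index_iota 0 15) big_mkord.
  apply/ffunP => k; rewrite !ffunE sum_ffunE [_ *: _]mulr1 (bigD1 k) //=.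
  rewrite big1 => [|i ik]; rewrite ffunE -/(u _) uE.
    by rewrite eqxx [_ *: _]mulr1 au addr0 addrC subrK.
  by rewrite (negbTE (_ : (i != k :> nat))) // [_ *: _]mulr0.
apply: cone_sum => g; rewrite /a; case: ifP => // _; by rewrite subr_ge0.
Qed.

Lemma trinomials_wf : all wf_trinomial trinomials.
Proof. by vm_compute. Qed.

Lemma pieces_cover x : (forall t, t \in trinomials -> (1 < count id (real_minimizer_bits t x))%N) ->
  exists2 G, G \in pieces & cone G x.
Proof.
move=> valid; rewrite /pieces.
have : forall p, p \in zip (iota 0 25) trinomials -> p.2 \in trinomials.
  move=> p /(nthP (0%N, [::]))[i lt <-].
  rewrite nth_zip_cond lt /=; apply: mem_nth.
  by move: lt; rewrite size_zip leq_min => /andP[].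
have : exists2 G, G \in [:: unit_generators] & cone G x.
  by exists unit_generators; [rewrite mem_head|apply: unit_cone].
elim: (zip _ _) [:: unit_generators] => // p s IH Q hQ hs; rewrite [foldl _ _ _]/=;
  apply: IH => [|q qs].
  have pt : p.2 \in trinomials by apply: hs; rewrite mem_head.
  have := refine_allP (allP trinomials_wf _ pt) (valid _ pt) hQ.
  by case: ifP => // _; apply: pruneP_cone.
by apply: hs; rewrite inE qs orbT.
Qed.

End Model.

End Cover.

(** * Minimizer signatures *)

Section Signatures.
Local Open Scope ring_scope.

Lemma mem_radix_undup n (L : seq (seq bool)) : all (fun s => size s == n) L -> radix_undup n L =i L.
Proof.
elim: n L => [|n IH] [|s0 L0] //.
  move=> /= /andP[/nilP -> h] s; rewrite !inE; case: eqP => //= ns.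
  by apply/esym/negbTE/negP => /(allP h) /nilP.
set L := s0 :: L0 => hL s.
have -> : radix_undup n.+1 L = map (cons true) (radix_undup n [seq behead l | l <- L & head false
  l]) ++
    map (cons false) (radix_undup n [seq behead l | l <- L & ~~ head false l]) by [].
rewrite mem_cat.
have sub (b : bool) : map (cons b) (radix_undup n [seq behead l | l <- L & head false l == b]) =i
    [seq l <- L | head false l == b].
  move=> u; rewrite mem_filter; apply/mapP/andP.
    move=> [v]; rewrite IH; last first.
      by apply/allP => _ /mapP[l + ->];
        rewrite mem_filter size_behead => /andP[_ /(allP hL)/eqP ->].
    move=> /mapP[l]; rewrite mem_filter => /andP[/eqP hd lL] -> -> /=.
    have := allP hL _ lL; case: l hd lL => //= c l -> lL _; by rewrite eqxx.
  move=> [/eqP hd uL]; exists (behead u); last first.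
    by have := allP hL _ uL; case: u uL hd => //= c u _ ->.
  rewrite IH; last first.
    by apply/allP => _ /mapP[l + ->]; rewrite mem_filter size_behead => /andP[_ /(allP hL)/eqP ->].
  by apply: map_f; rewrite mem_filter hd eqxx.
have -> : [seq l <- L | head false l] = [seq l <- L | head false l == true].
  by apply: eq_filter => l; rewrite eqb_id.
have -> : [seq l <- L | ~~ head false l] = [seq l <- L | head false l == false].
  by apply: eq_filter => l; rewrite eqbF_neg.
by rewrite !sub !mem_filter; case: (head false s) => /=; rewrite ?orbF.
Qed.

Lemma radix_undup_uniq n (L : seq (seq bool)) : uniq (radix_undup n L).
Proof.
elim: n L => [|n IH] [|s0 L0] //; rewrite [radix_undup _ _]/= cat_uniq.
rewrite !map_inj_uniq ?IH ?andbT //; try by move=> ? ? [].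
by apply/hasPn => _ /mapP[s _ ->]; apply/mapP => -[].
Qed.

Lemma size_meet_bits a b : size (meet_bits a b) = minn (size a) (size b).
Proof. by rewrite size_map size_zip. Qed.

Lemma meet_bitsE x a y b : meet_bits (x :: a) (y :: b) = (x && y) :: meet_bits a b.
Proof. by []. Qed.

Lemma bits_le_refl a : bits_le a a.
Proof. by elim: a => //= -[]. Qed.

Lemma bits_le_meet s a b : size a = size b -> bits_le s (meet_bits a b) = bits_le s a && bits_le s
  b.
Proof.
elim: s a b => [|x s IH] [|y a] [|z b] //= [] /IH e; rewrite -/(meet_bits a b) e.
by case: x; case: y; case: z => //=; rewrite andbF.
Qed.

Lemma bits_le_anti a b : size a = size b -> bits_le a b -> bits_le b a -> a = b.
Proof.
elim: a b => [|x a IH] [|y b] //= [] /IH h.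
by case: x; case: y => //= h1 h2; rewrite h.
Qed.

Lemma bits_le_full s n : size s = n -> bits_le (nseq n true) s = all id s.
Proof. by move=> <-; elim: s => //= -[]. Qed.

Local Arguments minimal : simpl never.

Section Signature.
Variable R : realType.
Local Notation X := {ffun 'I_15 -> R^o}.
Local Notation one_vec := (one_vec R).
Local Notation vec := (vec R).
Implicit Types (x y : X) (g : seq nat) (t G : seq (seq nat)) (l : R) (ts : seq (seq (seq nat))).

Lemma wf_trinomialE t : wf_trinomial t -> exists m1 m2 m3,
  t = [:: m1; m2; m3] /\ [/\ all (ltn^~ 15) m1, all (ltn^~ 15) m2, all (ltn^~ 15) m3,
    size m2 = size m1 & size m3 = size m1].
Proof.
case: t => [|m1 [|m2 [|m3 []]]] // /and3P[_ /and4P[h1 h2 h3 _] /= /and4P[_ /eqP e2 /eqP e3 _]].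
by exists m1, m2, m3.
Qed.

Lemma size_signature ts x : all wf_trinomial ts ->
  size (signature ts x) = (3 * size ts)%N.
Proof.
elim: ts => //= t ts IH /andP[/and3P[/eqP sz _ _] /IH e].
by rewrite /signature /= size_cat -/(signature ts x) e size_map sz mulnS.
Qed.

Lemma signature_one ts l : all wf_trinomial ts ->
  signature ts (l *: one_vec) = nseq (3 * size ts) true.
Proof.
elim: ts => // t ts IH /andP[/wf_trinomialE[m1 [m2 [m3 [-> [_ _ _ e2 e3]]]]] /IH e].
rewrite mulnS /signature /= -/(signature ts _) e /minimal /=.
by rewrite !mdotZ !mdot_one e2 e3 lexx.
Qed.

Lemma signature_vec ts g : all wf_trinomial ts ->
  signature ts (vec g) = flatten [seq minimizer_bits t g | t <- ts].
Proof.
elim: ts => // t ts IH /andP[/wf_trinomialE[m1 [m2 [m3 [-> [h1 h2 h3 _ _]]]]] /IH e].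
rewrite /signature /= -/(signature ts _) e /minimal /minimizer_bits /=.
by rewrite !mdot_vec // !ler_nat.
Qed.

Lemma signatureZ ts x l : 0 < l -> signature ts (l *: x) = signature ts x.
Proof.
move=> l0; rewrite /signature; congr flatten; apply: eq_map => t.
apply: eq_map => m; apply: eq_all => m'.
by rewrite !mdotZ ler_pM2l.
Qed.

Lemma minimalD t x y m m' : m \in t -> minimal t x m -> minimal t y m -> m' \in t ->
  minimal t (x + y) m' = minimal t x m' && minimal t y m'.
Proof.
move=> mt /allP hx /allP hy m't; apply/allP/andP.
  move=> h; have := h m mt; rewrite !mdotD => h1.
  have h2 := hx m' m't; have h3 := hy m' m't.
  by split; apply/allP => m'' m''t; [have h4 := hx m'' m''t|have h4 := hy m'' m''t]; lra.
by move=> [/allP h1 /allP h2] m'' m''t; rewrite !mdotD lerD ?h1 ?h2.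
Qed.

(** Two minimal monomials in each block of the meet yield in particular one common to [x] and [y],
    which is what [minimalD] needs. *)
Lemma signatureD ts x y : all wf_trinomial ts ->
  attained_twice (meet_bits (signature ts x) (signature ts y)) ->
  signature ts (x + y) = meet_bits (signature ts x) (signature ts y).
Proof.
elim: ts => // t ts IH /andP[/wf_trinomialE[m1 [m2 [m3 [-> _]]]] /IH {}IH].
rewrite /signature /= -/(signature ts _) -/(signature ts _) -/(signature ts _).
rewrite !meet_bitsE => /andP[h /IH ->].
have D k : k \in [:: m1; m2; m3] -> minimal [:: m1; m2; m3] x k && minimal [:: m1; m2; m3] y k ->
  {in [:: m1; m2; m3], forall m, minimal [:: m1; m2; m3] (x + y) m =
     minimal [:: m1; m2; m3] x m && minimal [:: m1; m2; m3] y m}.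
  by move=> kt /andP[kx ky] m mt; apply: (minimalD kt).
have [k kt hk] : exists2 k, k \in [:: m1; m2; m3] &
    minimal [:: m1; m2; m3] x k && minimal [:: m1; m2; m3] y k.
  move: h; case e1 : (_ && _) => /=; first by exists m1; rewrite ?e1 // !inE eqxx.
  case e2 : (_ && _) => /=; first by exists m2; rewrite ?e2 // !inE eqxx orbT.
  by case: (_ && _).
by rewrite !(D k kt hk) // !inE eqxx ?orbT.
Qed.

Lemma face_bits_sub g G : {subset face_bits G <= face_bits (g :: G)}.
Proof. by move=> s sG; rewrite /= mem_cat sG. Qed.

Lemma signature_trinomials_vec g : signature trinomials (vec g) = bits g.
Proof. exact: signature_vec trinomials_wf. Qed.

Lemma size_trinomials : size trinomials = 55%N.
Proof. by []. Qed.

Lemma size_signature_trinomials x : size (signature trinomials x) = 165%N.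
Proof. by rewrite size_signature ?trinomials_wf // size_trinomials. Qed.

Lemma size_bits g : size (bits g) = 165%N.
Proof. by rewrite -signature_trinomials_vec size_signature_trinomials. Qed.

Lemma signature_cone_step g x l : 0 < l ->
  attained_twice (meet_bits (bits g) (signature trinomials x)) ->
  signature trinomials (x + l *: vec g) = meet_bits (bits g) (signature trinomials x).
Proof.
move=> l0 h; rewrite addrC signatureD ?trinomials_wf // signatureZ //.
  by rewrite signature_trinomials_vec.
by rewrite signature_trinomials_vec.
Qed.

(** A generator with coefficient 0 can be skipped, and a positive multiple contributes exactly its
    own signature; the set of generators used by [x] is thus the subset whose meet is its
    signature. *)
Lemma face_bitsP G x : {in face_bits G, forall s, attained_twice s} -> cone G x ->
  signature trinomials x \in face_bits G.
Proof.
elim: G x => [|g G IH] x hG.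
  by move=> [l ->]; rewrite signature_one ?trinomials_wf // mem_head.
move=> [l l0 hc]; have sG := IH _ (fun s h => hG s (face_bits_sub g h)) hc.
move: l0; rewrite le_eqVlt => /orP[/eqP l0|l0].
  by move: sG; rewrite -l0 scale0r subr0; apply: face_bits_sub.
have mG : meet_bits (bits g) (signature trinomials (x - l *: vec g)) \in face_bits (g :: G).
  by rewrite /= mem_cat (map_f (meet_bits (bits g)) sG) orbT.
by rewrite -[x](subrK (l *: vec g)) signature_cone_step // hG.
Qed.

(** The sum of the generators in the chosen subset, each taken once, has the required signature. *)
Lemma face_bits_realized G s : {in face_bits G, forall s, attained_twice s} -> s \in face_bits G ->
  exists x, signature trinomials x = s.
Proof.
elim: G s => [|g G IH] s hG.
  by rewrite inE => /eqP ->; exists (0 *: one_vec); rewrite signature_one ?trinomials_wf.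
have {}IH s' := IH s' (fun s h => hG s (face_bits_sub g h)).
move=> hs; have := hG _ hs; move: hs; rewrite /= mem_cat => /orP[/IH //|/mapP[s' /IH[x <-] ->] gd].
by exists (x + 1 *: vec g); rewrite signature_cone_step.
Qed.

(** The signature of [x] is a meet, so every generator that occurs in [x] with a positive
    coefficient has a signature containing it, and hence containing [s]. *)
Lemma cone_span G x s : {in face_bits G, forall s, attained_twice s} -> cone G x ->
  bits_le s (signature trinomials x) ->
  x \in <<one_vec :: [seq vec g | g <- G & bits_le s (bits g)]>>%VS.
Proof.
elim: G x => [|g G IH] x hG.
  by move=> [l ->] _ /=; rewrite memvZ // memv_span // mem_head.
move=> [l l0 hc] hs.
have {}IH := IH _ (fun s h => hG s (face_bits_sub g h)) hc.
have sub : (<<one_vec :: [seq vec h | h <- G & bits_le s (bits h)]>> <=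
            <<one_vec :: [seq vec h | h <- g :: G & bits_le s (bits h)]>>)%VS.
  apply: sub_span => y; rewrite /= !inE => /orP[-> //|yG]; apply/orP; right.
  by case: ifP => _ //=; rewrite inE yG orbT.
move: l0; rewrite le_eqVlt => /orP[/eqP l0|l0].
  by move: IH; rewrite -l0 scale0r subr0 => /(_ hs); apply: (subvP sub).
have sG := face_bitsP (fun s h => hG s (face_bits_sub g h)) hc.
have mG : meet_bits (bits g) (signature trinomials (x - l *: vec g)) \in face_bits (g :: G).
  by rewrite /= mem_cat (map_f (meet_bits (bits g)) sG) orbT.
move: hs; rewrite -{1}[x](subrK (l *: vec g)) signature_cone_step ?hG //.
rewrite bits_le_meet ?size_bits ?size_signature_trinomials // => /andP[hg /IH /(subvP sub) h].
rewrite -[x](subrK (l *: vec g)) memvD // memvZ // memv_span //.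
by rewrite /= hg /= !inE eqxx orbT.
Qed.

End Signature.

End Signatures.

(** * Dimensions of cones *)

Section Dimensions.
Local Open Scope ring_scope.

Section Echelon.
Variable R : realType.
Local Notation X := {ffun 'I_15 -> R^o}.
Implicit Types (r e : seq int) (E : seq (nat * seq int)).

Definition int_vec r : X := [ffun i : 'I_15 => (nth 0 r i)%:~R].

(** Only later rows must vanish at a given pivot. This already gives independence, peeling rows from
    the head, and new rows can be appended without touching the old ones. *)
Fixpoint is_echelon E : Prop :=
  if E is (p, e) :: E' then
    [/\ (p < 15)%N, size e = 15%N, nth 0 e p != 0,
        {in E', forall q, nth 0 q.2 p = 0} & is_echelon E']
  else True.

Lemma int_vec_combine (a b : int) e r : size e = 15%N -> size r = 15%N ->
  int_vec [seq a * x.2 - b * x.1 | x <- zip e r] =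
  a%:~R *: int_vec r - b%:~R *: int_vec e.
Proof.
move=> se sr; apply/ffunP => i; rewrite !ffunE (nth_map (0, 0)) ?size_zip ?se ?sr //.
by rewrite nth_zip ?se ?sr //= rmorphB !rmorphM.
Qed.

(** Elimination is free of fractions, so the row is recovered only up to a nonzero factor [c] modulo
    the span. The second clause is what keeps the zero made at one pivot while later rows are
    subtracted. *)
Lemma echelon_reduceP E r : is_echelon E -> size r = 15%N ->
  [/\ size (echelon_reduce E r) = 15%N,
      forall q, {in E, forall x, nth 0 x.2 q = 0} -> nth 0 r q = 0 -> nth 0 (echelon_reduce E r) q
        = 0,
      {in E, forall x, nth 0 (echelon_reduce E r) x.1 = 0}
    & exists2 c : R, c != 0 & int_vec (echelon_reduce E r) - c *: int_vec r \in <<[seq int_vec x.2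
      | x <- E]>>%VS].
Proof.
elim: E r => [|[p e] E IH] r.
  by move=> _ sr; split=> //; exists 1; rewrite ?oner_eq0 // scale1r subrr mem0v.
move=> /= [p15 se ep0 eE hE] sr.
set r1 := (X in echelon_reduce E X).
have sr1 : size r1 = 15%N by rewrite /r1; case: ifP => // _; rewrite size_map size_zip se sr.
have r1q q : nth 0 e q = 0 -> nth 0 r q = 0 -> nth 0 r1 q = 0.
  move=> e0 r0; rewrite /r1; case: ifP => // _; have [lt|ge] := ltnP q 15.
    by rewrite (nth_map (0, 0)) ?size_zip ?se ?sr // nth_zip ?se ?sr //= e0 r0 !mulr0 subrr.
  by rewrite nth_default // size_map size_zip se sr.
have r1p : nth 0 r1 p = 0.
  rewrite /r1; case: eqP => // _.
  by rewrite (nth_map (0, 0)) ?size_zip ?se ?sr // nth_zip ?se ?sr //= mulrC subrr.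
have [s1 keep zero [c c0 hc]] := IH r1 hE sr1; split=> //.
- move=> q hq r0; apply: keep => [e' e'E|]; first by apply: hq; rewrite inE e'E orbT.
  by apply: r1q => //; apply: (hq (p, e)); rewrite mem_head.
- move=> q; rewrite inE => /orP[/eqP -> /=|]; last exact: zero.
  exact: keep.
have [d d0 [b er1]] : exists2 d : R, d != 0 & exists b : R, int_vec r1 = d *: int_vec r - b *:
  int_vec e.
  rewrite /r1; case: ifP => _; first by exists 1; rewrite ?oner_eq0 //; exists 0;
    rewrite scale1r scale0r subr0.
  exists (nth 0 e p)%:~R; first by rewrite intr_eq0.
  by exists (nth 0 r p)%:~R; rewrite int_vec_combine.
exists (c * d); first by rewrite mulf_neq0.
have -> : int_vec (echelon_reduce E r1) - (c * d) *: int_vec r =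
   (int_vec (echelon_reduce E r1) - c *: int_vec r1) - (c * b) *: int_vec e.
  by rewrite er1; apply/ffunP => i; rewrite !ffunE /GRing.scale /=; ring.
rewrite memvB //; last by rewrite memvZ // memv_span // mem_head.
by apply: (subvP (sub_span _)) hc => x xE; rewrite inE xE orbT.
Qed.

Lemma is_echelon_rcons E p e : is_echelon E -> (p < 15)%N -> size e = 15%N -> nth 0 e p != 0 ->
  {in E, forall q, nth 0 e q.1 = 0} -> is_echelon (rcons E (p, e)).
Proof.
elim: E => [|[q f] E IH] /=; first by move=> *; split.
move=> [q15 sf fq fE hE] p15 se ep h; split=> //.
  move=> x; rewrite mem_rcons inE => /orP[/eqP ->|/fE //] /=.
  by apply: (h (q, f)); rewrite mem_head.
by apply: IH => // x xE; apply: h; rewrite inE xE orbT.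
Qed.

Lemma echelon_insertP E r : is_echelon E -> size r = 15%N ->
  is_echelon (echelon_insert E r) /\
  <<[seq int_vec x.2 | x <- echelon_insert E r]>>%VS = (<<[seq int_vec x.2 | x <- E]>> + <[int_vec
    r]>)%VS.
Proof.
move=> hE sr; have [s1 _ zero [c c0 hc]] := echelon_reduceP hE sr; rewrite /echelon_insert.
set r' := echelon_reduce E r in s1 zero hc *; set U := <<[seq int_vec x.2 | x <- E]>>%VS in hc *.
have er : int_vec r = c^-1 *: int_vec r' - c^-1 *: (int_vec r' - c *: int_vec r).
  by rewrite -scalerBr opprB addrC subrK scalerA mulVf // scale1r.
have er' : int_vec r' = (int_vec r' - c *: int_vec r) + c *: int_vec r by rewrite subrK.
case: ifP => [lt|ge].
  have p0 : nth 0 r' (find (fun a => a != 0) r') != 0 by apply: (@nth_find _ 0 (fun a => a != 0));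
    rewrite has_find.
  split; first by apply: is_echelon_rcons => //; rewrite -s1.
  rewrite map_rcons -cats1 span_cat span_seq1 /= -/U; apply/eqP;
    rewrite eqEsubv !subv_add !addvSl /=.
  rewrite -!memvE; apply/andP; split.
    by rewrite er' memv_add // memvZ // memv_line.
  by rewrite er addrC memv_add // ?memvN memvZ // memv_line.
split=> //; apply/esym/addv_idPl; rewrite -memvE er.
suff e0 : int_vec r' = 0 by rewrite {1}e0 scaler0 sub0r memvN memvZ.
apply/ffunP => i; rewrite !ffunE.
have : ~~ has (fun a => a != 0) r' by rewrite has_find ge.
by move=> /hasPn/(_ (nth 0 r' i)); rewrite mem_nth ?s1 // negbK => /(_ isT)/eqP ->.
Qed.

Lemma is_echelon_free E : is_echelon E -> free [seq int_vec x.2 | x <- E].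
Proof.
elim: E => [|[p e] E IH] /=; first by rewrite nil_free.
move=> [p15 se ep eE hE]; rewrite free_cons IH // andbT; apply/negP => hs.
suff : int_vec e (Ordinal p15) = 0 by rewrite ffunE /= => /eqP; rewrite intr_eq0 (negbTE ep).
rewrite (coord_span (X := in_tuple [seq int_vec x.2 | x <- E]) hs) sum_ffunE.
rewrite big1 // => i _; rewrite ffunE -tnth_nth.
have /mapP[q qE ->] : tnth (in_tuple [seq int_vec x.2 | x <- E]) i \in [seq int_vec x.2 | x <- E].
  exact: mem_tnth.
by rewrite ffunE /= eE // scaler0.
Qed.

Lemma echelonP (L : seq (seq int)) : all (fun r => size r == 15%N) L ->
  \dim <<[seq int_vec r | r <- L]>> = size (echelon L).
Proof.
move=> hL; rewrite /echelon.
suff [h1 h2] : is_echelon (foldl echelon_insert [::] L) /\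
   <<[seq int_vec x.2 | x <- foldl echelon_insert [::] L]>>%VS = <<[seq int_vec r | r <- L]>>%VS.
  by rewrite -h2; have := is_echelon_free h1; rewrite /free => /eqP ->; rewrite size_map.
have : is_echelon [::] by [].
suff gen E : is_echelon E -> is_echelon (foldl echelon_insert E L) /\
   <<[seq int_vec x.2 | x <- foldl echelon_insert E L]>>%VS = (<<[seq int_vec x.2 | x <- E]>> +
     <<[seq int_vec r | r <- L]>>)%VS.
  by move=> /gen; rewrite span_nil add0v.
elim: L hL E => [|r L IH] /=; first by move=> _ E hE; rewrite span_nil addv0.
move=> /andP[/eqP sr hL] E hE; have [h1 h2] := echelon_insertP hE sr.
by have [h3 ->] := IH hL _ h1; split=> //; rewrite h2 span_cons addvA.
Qed.

End Echelon.

Section Summary.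
Variable R : realType.
Local Notation X := {ffun 'I_15 -> R^o}.
Local Notation vec := (vec R).
Local Notation one_vec := (one_vec R).
Local Notation signature := (@signature R trinomials).
Implicit Types (x : X) (s : seq bool).

Definition valid x : Prop :=
  forall t, t \in trinomials -> (1 < count id (real_minimizer_bits t x))%N.

(* The list of cones is kept abstract, lest it be evaluated by unification. *)
Variable P : seq (seq (seq nat)).
Hypothesis P_certificate : certificate P.
Hypothesis P_cover : forall x, valid x -> exists2 G, G \in P & cone G x.

Definition signature_dim s := dimension (table P) s.

Lemma mem_signatures s :
  (s \in signatures P) = (s \in flatten [seq face_bits G | G <- P]).
Proof.
apply: mem_radix_undup; apply/allP => {}s /flatten_mapP[G _].
elim: G s => [|g G IH] s /=; first by rewrite inE => /eqP ->; rewrite size_nseq.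
rewrite mem_cat => /orP[/IH //|/mapP[s' /IH/eqP e ->]].
by rewrite size_meet_bits size_bits // e.
Qed.

Lemma attained_twice_face_bits G : G \in P -> {in face_bits G, forall s, attained_twice s}.
Proof.
move=> GP s sG; have /and5P[_ _ /allP h _ _] := P_certificate; apply: h.
by rewrite mem_signatures; apply/flatten_mapP; exists G.
Qed.

Lemma valid_signature x : valid x -> signature x \in signatures P.
Proof.
move=> /P_cover[G GP hc]; rewrite mem_signatures.
apply/flatten_mapP; exists G => //; exact: face_bitsP (attained_twice_face_bits GP) hc.
Qed.

Lemma signature_realized s : s \in signatures P -> exists x, signature x = s.
Proof.
rewrite mem_signatures => /flatten_mapP[G GP sG].
exact: face_bits_realized (attained_twice_face_bits GP) sG.
Qed.

Lemma attained_twice_signatures s : s \in signatures P -> attained_twice s.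
Proof. by have /and5P[_ _ /allP h _ _] := P_certificate; apply: h. Qed.

Lemma uniq_signatures : uniq (signatures P).
Proof. exact: radix_undup_uniq. Qed.

Definition cone_generators s := [seq g <- generators P | bits_le s (bits g)].

Lemma cone_generators_span x s : valid x -> bits_le s (signature x) ->
  x \in <<one_vec :: [seq vec g | g <- cone_generators s]>>%VS.
Proof.
move=> /P_cover[G GP hc] hs.
apply: (subvP (sub_span _)) (cone_span (attained_twice_face_bits GP) hc hs) => y.
rewrite !inE => /orP[-> //|/mapP[g]]; rewrite mem_filter => /andP[hg gG ->].
rewrite map_f ?orbT // mem_filter hg mem_undup_gen.
by apply/flattenP; exists G.
Qed.

Lemma generator_not_full g : g \in generators P -> ~~ all id (bits g).
Proof.
move=> gP; have /and5P[_ /allP h _ _ _] := P_certificate.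
by apply: (h (bits g, shifted g)); apply: (map_f (fun g => (bits g, shifted g))).
Qed.

(** The real vector of [shifted g]. Its vanishing first coordinate makes the span of such vectors
    meet the all-one line only in 0. *)
Definition normal_vec g : X := vec g - (nth 0%N g 0)%:R *: one_vec.

Lemma dim_cone_generators s :
  \dim <<[seq normal_vec g | g <- cone_generators s]>> = signature_dim s.
Proof.
have /and5P[/allP sz _ _ _ _] := P_certificate.
rewrite /signature_dim /dimension /table filter_map -map_comp.
rewrite -(@echelonP R) ?all_map; last first.
  by apply/allP => g; rewrite mem_filter /= size_map => /andP[_ /sz].
congr (\dim <<_>>); rewrite -map_comp; apply/eq_in_map => g.
rewrite mem_filter => /andP[_ /sz/eqP gs]; apply/ffunP => i.
rewrite !ffunE /= (nth_map 0%N) ?gs // rmorphB /= [_ *: 1]mulr1.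
by case: g {gs}.
Qed.

Lemma count_signature_dim k : (k < 4)%N ->
  count (fun s => signature_dim s == k.+1) (signatures P) = nth 0%N [:: 70; 370; 510; 150]%N k.
Proof.
move=> k4; have /and5P[_ _ _ _ /eqP <-] := P_certificate.
by rewrite (nth_map 0%N) ?size_iota // nth_iota // count_map.
Qed.

Lemma signature_dim_le s : s \in signatures P -> (signature_dim s <= 4)%N.
Proof.
move=> sS; have /and5P[_ _ _ /allP h _] := P_certificate.
exact: h (map_f _ sS).
Qed.

End Summary.

End Dimensions.

(** * Classification of the three-term relations *)

Section RelationData.

Definition common_part (es : seq (seq nat)) : seq nat :=
  if es is e :: es' then foldr multiset_inter e es' else [::].

(** In the model a relation is either an identity, all its monomials having the same exponents, or
    one of the 55 trinomials times a monomial. The bound on the size rules out relations with a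
    single monomial, which no point would satisfy. *)
Definition classified (q : relation) : bool :=
  let es := exponents q in
  let t := reduced es in
  (1 < size es) &&
  (if all (perm_eq (nth [::] es 0)) es then true else
    [&& size es == 3, has (perm_eq t) trinomials, size t == 3
      & all (fun p => perm_eq p.1 (p.2 ++ common_part es)) (zip es t)]).

(** Exchanging i and j, or k and l, or the two pairs, only permutes the monomials; these symmetries
    leave three of the 24 orders of four indices. *)
Definition ordered_relation (q : relation) : bool :=
  let: (s, i, j, k, l) := q in [&& uniq [:: s; i; j; k; l], i < j, k < l & i < k].

Definition for_relations (p : relation -> bool) : bool :=
  let n := iota 0 10 in
  all (fun i => all (fun j => if i < j then all (fun k => if i < k then all (fun l =>
    if k < l then all (fun s => if uniq [:: s; i; j; k; l] then p (s, i, j, k, l) else true) n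
    else true) n else true) n else true) n) n.

Lemma for_relationsP p s i j k l : for_relations p ->
  s < 10 -> i < 10 -> j < 10 -> k < 10 -> l < 10 ->
  ordered_relation (s, i, j, k, l) -> p (s, i, j, k, l).
Proof.
have m10 a : (a \in iota 0 10) = (a < 10) by rewrite mem_iota.
move=> h hs hi hj hk hl /and4P[u ij kl ik]; move: h.
move=> /allP/(_ i); rewrite m10 => /(_ hi)/allP/(_ j); rewrite m10 => /(_ hj); rewrite ij.
move=> /allP/(_ k); rewrite m10 => /(_ hk); rewrite ik.
move=> /allP/(_ l); rewrite m10 => /(_ hl); rewrite kl.
by move=> /allP/(_ s); rewrite m10 => /(_ hs); rewrite u.
Qed.

Lemma all_classified : for_relations classified.
Proof. by vm_compute. Qed.

(** There are 24 = 15 + 10 - 1 of them: among the 25 model and torus coordinates, the value 1 on the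
    first 15 is cancelled by -2/3 on the last 10, each basis involving two of the former and three
    of the latter. The remaining 86 bases are reached by [propagation_steps]. *)
Definition base_keys : seq (seq nat) :=
  [:: [:: 0; 1; 2]; [:: 0; 1; 4]; [:: 0; 2; 3]; [:: 0; 3; 7]; [:: 0; 3; 9]; [:: 0; 4; 8]; [:: 0;
    7; 9]; [:: 1; 3; 7]; [:: 1; 4; 6]; [:: 1; 7; 9]; [:: 2; 3; 6]; [:: 2; 3; 7]; [:: 2; 3; 8];
    [:: 2; 4; 6]; [:: 2; 5; 6]; [:: 2; 6; 8]; [:: 2; 8; 9]; [:: 3; 4; 5]; [:: 3; 4; 8]; [:: 3; 4;
    9]; [:: 3; 5; 6]; [:: 3; 7; 8]; [:: 4; 5; 7]; [:: 6; 7; 9]].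

(* Twice the coefficients of the 15 coordinates of the model, then of the 10
   coordinates of the torus, in terms of the values at [base_keys]; the
   coordinate 19 is normalised to 0. *)
Definition base_coordinates : seq (seq int) :=
  [:: [:: 0; 0; 3; -1; 0; 0; -2; 0; 0; 0; -1; 0; -2; 0; 0; 0; 0; 2; 2; -1; -2; 0; 0; 3];
      [:: 0; 0; -1; 3; 0; 0; -2; 0; 0; 0; -1; -2; 2; 2; 0; 0; 0; 2; -2; 1; -2; 0; 0; 1];
      [:: 0; 0; 1; -1; 0; 0; 0; 0; 0; 0; 1; 0; -2; 0; 0; 0; 0; 2; 2; -1; -2; 0; 0; 1];
      [:: 0; 0; 1; 1; 0; 0; -2; 0; -2; 2; 1; -2; -2; 2; 0; 0; 0; 2; 2; -1; -2; 0; 0; 1];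
      [:: 0; 0; 1; 1; 0; 0; -2; 0; 0; 0; -3; 0; 0; 2; 0; 0; 0; 0; 0; 1; 0; 0; 0; 1];
      [:: 0; 2; 1; -1; 0; 0; -2; 0; -2; 0; 1; 0; -2; 0; 0; 0; 0; 2; 2; -1; -2; 0; 0; 3];
      [:: 2; 0; 1; -1; 0; 0; -2; 0; -2; 0; 1; 0; -4; 0; 0; 0; 0; 2; 4; -1; -2; 0; 0; 3];
      [:: 0; 0; 3; -3; 0; 0; 0; 0; -2; 2; 1; 0; -4; 0; 0; 2; -2; 2; 4; -1; -2; 0; 0; 1];
      [:: 0; 0; 3; -3; 0; 0; 0; 0; -2; 2; 1; -2; -2; 2; 0; 0; -2; 2; 2; -1; -2; 2; 0; 1];
      [:: 0; 0; 1; -3; 0; 2; 0; 0; -2; 2; 3; 0; -2; 0; 0; 0; -2; 2; 2; -1; -2; 0; 0; 1];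
      [:: 0; 0; 1; 1; 0; 0; -2; 0; 0; 0; 1; -2; 0; 0; 0; 0; 0; 0; 0; 1; -2; 0; 2; 1];
      [:: 0; 0; 1; 1; 0; 0; -2; 0; 0; 0; -1; 0; -2; 0; 2; 0; 0; 0; 2; 1; -2; 0; 0; 1];
      [:: 0; 0; 3; -1; 0; 0; -2; 2; -2; 0; -1; -2; -2; 2; 0; 0; 0; 2; 2; -1; -2; 0; 0; 3];
      [:: 0; 0; 1; -1; 0; 0; 0; 0; -2; 2; 1; -2; 0; 2; 0; 0; -2; 2; 2; -1; -2; 0; 0; 1];
      [:: 0; 0; -1; 1; 2; 0; -2; 0; 0; 0; -1; 0; 0; 2; 0; 0; 0; 2; 0; -1; -2; 0; 0; 1];
      [:: 0; 0; 0; 0; 0; 0; 2; 0; 0; 0; 0; 0; 0; 0; 0; 0; 0; -2; 0; 0; 2; 0; 0; -2];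
      [:: 0; 0; -2; 2; 0; 0; 0; 0; 2; 0; -2; 0; 4; 0; 0; 0; 0; -2; -4; 2; 2; 0; 0; -2];
      [:: 0; 0; -2; 0; 0; 0; 2; 0; 0; 0; 2; 0; 2; 0; 0; 0; 0; 0; -2; 0; 0; 0; 0; -2];
      [:: 0; 0; -2; 2; 0; 0; 0; 0; 0; 0; 0; 0; 2; 0; 0; 0; 0; -2; -2; 2; 2; 0; 0; -2];
      [:: 0; 0; 0; 0; 0; 0; 0; 0; 0; 0; 0; 0; 0; 0; 0; 0; 0; 0; 0; 0; 0; 0; 0; 0];
      [:: 0; 0; -2; 0; 0; 0; 2; 0; 0; 0; 0; 0; 2; 0; 0; 0; 0; 0; -2; 0; 2; 0; 0; -2];
      [:: 0; 0; 0; 0; 0; 0; 0; 0; 0; 0; 0; 0; 0; 0; 0; 0; 0; -2; 0; 0; 2; 0; 0; 0];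
      [:: 0; 0; 0; -2; 0; 0; 2; 0; 0; 0; 2; 2; -2; -2; 0; 0; 0; 0; 2; -2; 0; 0; 0; 0];
      [:: 0; 0; 0; 0; 0; 0; 0; 0; 2; -2; -2; 2; 0; -2; 0; 0; 2; -2; 0; 0; 2; 0; 0; 0];
      [:: 0; 0; 0; -2; 0; 0; 2; 0; 0; 0; 2; 0; 0; -2; 0; 0; 0; 0; 0; 0; 0; 0; 0; 0]]%Z.

(* Starting from [base_keys], each of these binomial relations involves exactly
   one new basis. *)
Definition propagation_steps : seq relation :=
  [:: (0,1,2,3,7); (0,1,2,7,9); (2,0,1,3,7); (2,0,1,7,9); (2,0,3,4,6); (2,0,3,4,7); (2,0,3,4,8);
    (3,0,2,4,8); (3,0,2,4,9); (3,0,2,5,6); (3,0,2,6,7); (3,0,2,6,9); (3,0,4,5,6); (3,2,4,5,6);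
    (3,2,4,5,7); (4,0,2,3,5); (4,0,2,3,9); (4,1,2,6,7); (4,1,5,6,7); (6,1,3,4,7); (6,1,4,5,7);
    (6,1,4,7,9); (6,2,3,4,7); (7,0,1,2,4); (7,0,1,2,6); (7,0,4,6,9); (9,0,2,7,8); (9,0,4,7,8);
    (9,0,6,7,8); (9,1,2,4,7); (9,1,2,4,8); (9,1,3,4,7); (9,1,4,6,7); (0,1,2,6,7); (0,2,3,4,6);
    (0,2,3,5,6); (0,2,3,6,9); (1,0,4,6,9); (1,0,4,8,9); (1,2,4,6,9); (1,3,4,6,9); (1,4,6,7,8);
    (2,0,1,3,4); (2,0,3,5,9); (2,0,4,5,7); (2,0,5,6,9); (2,0,5,8,9); (2,1,3,5,9); (3,0,1,2,5);
    (3,0,1,2,6); (3,0,1,5,7); (3,0,1,5,9); (4,0,1,2,9); (5,0,1,2,3); (5,0,1,2,8); (5,0,1,3,4);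
    (5,0,1,3,6); (5,0,1,3,7); (5,0,1,3,8); (5,0,1,3,9); (5,0,1,6,8); (5,0,2,3,9); (5,0,2,4,9);
    (5,0,2,6,9); (5,0,2,7,9); (5,0,2,8,9); (6,0,1,2,3); (6,0,1,5,8); (6,0,1,7,8); (6,0,2,3,8);
    (6,0,4,7,8); (6,1,2,3,8); (7,0,1,2,5); (7,0,1,8,9); (7,0,2,3,8); (7,0,3,8,9); (7,0,4,6,8);
    (7,0,5,8,9); (8,0,1,4,6); (8,0,2,5,6); (8,0,3,5,6); (8,0,3,7,9); (8,0,4,5,6); (8,1,2,4,6);
    (8,1,3,4,6); (0,1,4,5,8)].

Definition extended_weight (l : seq nat) : seq nat := weight l ++ map (addn 15) l.

Definition int_sum (s : seq int) : int := foldr +%R 0%R s.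

(** The coordinates are a right inverse of the extended weights on the base keys; the factor 2 keeps
    the table integral. *)
Lemma base_coordinatesP : all (fun k => all (fun k' =>
      int_sum [seq nth 0%R (nth [::] base_coordinates j) k' |
                j <- extended_weight (nth [::] base_keys k)] ==
      if k == k' then 2%R else 0%R)
    (iota 0 24)) (iota 0 24).
Proof. by vm_compute. Qed.

(** A binomial relation reads w_a + w_b = w_c + w_d on the prevariety, so it determines a value only
    when exactly one of the four bases is still unknown. *)
Definition propagate (K : seq (seq nat)) (q : relation) : seq (seq nat) :=
  if monomials q is [:: (a, b); (c, d)] then
    if [seq l <- [:: a; b; c; d] | ~~ mem_gen K l] is [:: l] then l :: K else K
  else K.

Definition all_keys : seq (seq nat) :=
  [seq l <- [seq a :: l | a <- iota 0 10, l <- [seq [:: b; c] | b <- iota 0 10, c <- iota 0 10]]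
  | sorted ltn l && is_key l].

Lemma propagation_complete :
  all (mem_gen (foldl propagate base_keys propagation_steps)) all_keys.
Proof. by vm_compute. Qed.

Definition valid_relation (q : relation) : bool :=
  let: (s, i, j, k, l) := q in
  uniq [:: s; i; j; k; l] && all (ltn^~ 10) [:: s; i; j; k; l].

Lemma valid_propagation_steps : all valid_relation propagation_steps.
Proof. by vm_compute. Qed.

Lemma valid_representatives : all valid_relation representatives.
Proof. by vm_compute. Qed.

Lemma representatives_ok : all (fun q => let es := exponents q in (size es == 3) &&
   all (fun p => perm_eq p.1 (p.2 ++ common_part es)) (zip es (reduced es))) representatives.
Proof. by vm_compute. Qed.

Lemma propagation_steps_binomial :
  all (fun q => all (perm_eq (nth [::] (exponents q) 0)) (exponents q)) propagation_steps.
Proof. by vm_compute. Qed.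

End RelationData.

(** * Monomials of the three-term relations *)

Section ThreeTermRelations.
Local Open Scope ring_scope.

Section ThreeTerm.
Variables (E : finType) (d : nat) (M : matroid E d).
Local Notation n := #|basis M|.
Implicit Types (A B C S : {set E}) (a b : basis M) (i j k l : E).

Definition pair_monomial a b : 'X_{1..n} := (U_(enum_rank a) + U_(enum_rank b))%MM.

Definition pair_support A B : seq 'X_{1..n} :=
  if insub A is Some a then if insub B is Some b then [:: pair_monomial a b] else [::]
  else [::].

Definition three_term_support (S : {set E}) (i j k l : E) : seq 'X_{1..n} :=
  let e (x y : E) : {set E} := x |: (y |: S) in
  pair_support (e i j) (e k l) ++ pair_support (e i k) (e j l) ++ pair_support (e i l) (e j k).

Lemma pair_support_uniq A B : uniq (pair_support A B).
Proof. by rewrite /pair_support; case: insub => // a; case: insub. Qed.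

Lemma plucker_mul A B : plucker_var M A * plucker_var M B =
  \sum_(m <- pair_support A B) 'X_[m].
Proof.
rewrite /plucker_var /pair_support; case: insub => [a|]; last by rewrite mul0r big_nil.
case: insub => [b|]; last by rewrite mulr0 big_nil.
by rewrite big_seq1 mpolyXD.
Qed.

Lemma mcoeff_pair_support A B m :
  (\sum_(m' <- pair_support A B) 'X_[m'] : {mpoly int[n]})@_m = (m \in pair_support A B)%:R.
Proof.
rewrite /pair_support; case: insub => [a|]; last by rewrite big_nil mcoeff0.
case: insub => [b|]; last by rewrite big_nil mcoeff0.
by rewrite big_seq1 mcoeffX inE eq_sym.
Qed.

Lemma pair_monomialC a b : pair_monomial a b = pair_monomial b a.
Proof. exact: addmC. Qed.

Lemma pair_supportC A B : pair_support A B = pair_support B A.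
Proof.
rewrite /pair_support; case: (insub A) => [a|]; case: (insub B) => [b|] //.
by rewrite pair_monomialC.
Qed.

(** The variable of [A] divides every monomial of the first product and none of the second. *)
Lemma pair_support_disjoint A B C D m : A != C -> A != D ->
  m \in pair_support A B -> m \notin pair_support C D.
Proof.
rewrite /pair_support; case: insubP => // a _ <-; case: insubP => // b _ _ AC AD.
rewrite inE => /eqP ->; case: insubP => // c _ eC; case: insubP => // d' _ eD.
rewrite inE; apply/eqP => /(congr1 (fun m : 'X_{1..n} => m (enum_rank a))).
rewrite !mnmDE !mnm1E eqxx !(inj_eq enum_rank_inj) -(val_eqE c a) -(val_eqE d' a) eC eD.
by rewrite (eq_sym C) (eq_sym D) (negbTE AC) (negbTE AD).
Qed.

(** The monomials of the three products are distinct, so nothing cancels and the signs do not affect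
    the support. *)
Lemma three_term_msupp S i j k l : uniq [:: i; j; k; l] ->
  all (fun x => x \notin S) [:: i; j; k; l] ->
  perm_eq (msupp (three_term M S i j k l)) (three_term_support S i j k l).
Proof.
rewrite /= !inE !negb_or !andbT => /and3P[/and3P[ij ik il] /andP[jk jl] kl] /and4P[iS jS kS lS].
have ne (a b c d' : E) : a \notin S -> a != c -> a != d' -> a |: (b |: S) != c |: (d' |: S).
  move=> aS ac ad; apply/eqP => /setP/(_ a); rewrite !inE eqxx (negbTE aS) (negbTE ac) (negbTE ad).
  by [].
have neC (a b c d' : E) : b \notin S -> b != c -> b != d' -> a |: (b |: S) != c |: (d' |: S).
  by move=> bS bc bd; rewrite finset.setUCA; apply: ne.
set ps1 := pair_support (i |: (j |: S)) (k |: (l |: S)).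
set ps2 := pair_support (i |: (k |: S)) (j |: (l |: S)).
set ps3 := pair_support (i |: (l |: S)) (j |: (k |: S)).
have d12 m : m \in ps1 -> m \notin ps2.
  by apply: pair_support_disjoint; [apply: neC => //; rewrite eq_sym|apply: ne].
have d13 m : m \in ps1 -> m \notin ps3.
  by apply: pair_support_disjoint; [apply: neC => //; rewrite eq_sym|apply: ne].
have d23 m : m \in ps2 -> m \notin ps3.
  by apply: pair_support_disjoint; [apply: neC => //; rewrite eq_sym|apply: ne].
apply: uniq_perm; first exact: msupp_uniq.
  rewrite !cat_uniq !pair_support_uniq !andbT /=; apply/andP; split.
    apply/hasPn => m; rewrite mem_cat => /orP[] h; apply/negP => /= h'.
      by move: (d12 _ h'); rewrite h.
    by move: (d13 _ h'); rewrite h.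
  by apply/hasPn => m h; apply/negP => /= h'; move: (d23 _ h'); rewrite h.
move=> m; rewrite mcoeff_msupp /three_term !plucker_mul mcoeffD mcoeffB.
rewrite !mcoeff_pair_support -/ps1 -/ps2 -/ps3 !mem_cat.
have := d12 m; have := d13 m; have := d23 m.
case: (m \in ps1); case: (m \in ps2); case: (m \in ps3) => //= h1 h2 h3;
  first [by move: (h1 isT)|by move: (h2 isT)|by move: (h3 isT)].
Qed.

Lemma three_term_support_swap12 S i j k l :
  perm_eq (three_term_support S i j k l) (three_term_support S j i k l).
Proof.
rewrite /three_term_support (finset.setUCA [set i]%SET [set j]%SET) perm_cat2l perm_catC.
by rewrite (pair_supportC (i |: (k |: S))) (pair_supportC (i |: (l |: S))).
Qed.

Lemma three_term_support_swap34 S i j k l :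
  perm_eq (three_term_support S i j k l) (three_term_support S i j l k).
Proof.
by rewrite /three_term_support (finset.setUCA [set k]%SET [set l]%SET) perm_cat2l perm_catC.
Qed.

Lemma three_term_support_swap_pairs S i j k l :
  perm_eq (three_term_support S i j k l) (three_term_support S k l i j).
Proof.
rewrite /three_term_support pair_supportC perm_cat2l.
rewrite (finset.setUCA [set k]%SET [set i]%SET) (finset.setUCA [set l]%SET [set j]%SET) perm_cat2l.
by rewrite pair_supportC (finset.setUCA [set k]%SET [set j]%SET) (finset.setUCA [set l]%SET [set
  i]%SET).
Qed.

Definition relation_index : finType := ({set E} * E * E * E * E)%type.

Definition is_relation (p : relation_index) : bool :=
  let: (A, i, j, k, l) := p in
  [&& (#|A| + 2 == d)%N, uniq [:: i; j; k; l] & all (fun x => x \notin A) [:: i; j; k; l]].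

(** The general results on prevarieties are stated for a finite list of polynomials; sums over it
    provide the generic points and the supporting forms. *)
Definition three_term_seq : seq {mpoly int[n]} :=
  [seq (let: (A, i, j, k, l) := p in three_term M A i j k l) | p <- enum is_relation].

Lemma three_term_seqP f : f \in three_term_seq <-> three_term_relations M f.
Proof.
split=> [/mapP[[[[[S i] j] k] l]]|[S [i [j [k [l [hS u a ->]]]]]]].
  rewrite mem_enum => /and3P[/eqP hS u a] ->.
  by exists S, i, j, k, l.
apply/mapP; exists (S, i, j, k, l) => //.
by rewrite mem_enum unfold_in /is_relation hS eqxx u a.
Qed.

Lemma trop_pair_monomial (R : realType) a b (w : {ffun basis M -> R^o}) :
  trop_monomial (pair_monomial a b) w = w a + w b.
Proof.
rewrite /trop_monomial /pair_monomial.
under eq_bigr do rewrite mnmDE !mnm1E natrD mulrDl.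
rewrite big_split /=; congr (_ + _).
  rewrite (bigD1 a) //= eqxx mul1r big1 ?addr0 // => c ca.
  by rewrite (inj_eq enum_rank_inj) eq_sym (negbTE ca) mul0r.
rewrite (bigD1 b) //= eqxx mul1r big1 ?addr0 // => c cb.
by rewrite (inj_eq enum_rank_inj) eq_sym (negbTE cb) mul0r.
Qed.

End ThreeTerm.

Lemma dressianE (R : realType) (E : finType) (d : nat) (M : matroid E d) :
  dressian R M = @trop_prevariety R _ (three_term_seq M).
Proof.
apply/seteqP; split=> w h f ff; apply: h; exact/three_term_seqP.
Qed.

Lemma dressian_fanE (R : realType) (E : finType) (d : nat) (M : matroid E d) :
  dressian_fan R M = [set C | exists2 v, @trop_prevariety R _ (three_term_seq M) v &
    C = fan_cone (three_term_seq M) v]%classic.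
Proof.
rewrite -fan_cones /dressian_fan; congr common_refinement.
apply/seteqP; split=> f; first by move/three_term_seqP.
by move=> h; apply/three_term_seqP.
Qed.

End ThreeTermRelations.

(** * Relations of the Desargues matroid *)

Section DesarguesRelations.
Local Open Scope ring_scope.

Definition point_set (l : seq nat) : {set 'I_10} := [set i : 'I_10 | val i \in l]%SET.

(** Strictly increasing lists represent sets of points uniquely, so the list computations decide
    statements about bases. *)
Definition sorted_points (l : seq nat) : bool := sorted ltn l && all (ltn^~ 10)%N l.

Lemma point_setK l : sorted_points l -> [seq val i | i <- enum (point_set l)] = l.
Proof.
move=> /andP[sl l10].
have -> : [seq val i | i <- enum (point_set l)] = [seq x <- iota 0 10 | x \in l].
  rewrite -val_enum_ord filter_map; congr map; rewrite {1}/enum_mem -enumT.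
  by apply: eq_filter => i; rewrite /= inE.
apply: (irr_sorted_eq ltn_trans ltnn) => //.
  by apply: sorted_filter; [exact: ltn_trans|exact: iota_ltn_sorted].
move=> x; rewrite mem_filter mem_iota /= add0n.
by case: (boolP (x \in l)) => // /(allP l10).
Qed.

Lemma point_set_inj l l' : sorted_points l -> sorted_points l' ->
  point_set l = point_set l' -> l = l'.
Proof. by move=> /point_setK {2}<- /point_setK {2}<- ->. Qed.

Lemma lines_sorted l : l \in desargues_lines -> sorted_points l.
Proof. by apply: allP l; vm_compute. Qed.

Lemma point_set_basis l : sorted_points l -> size l = 3%N ->
  (point_set l \in desargues_bases) = is_key l.
Proof.
move=> hl sz; rewrite inE.
have -> : #|point_set l| == 3%N.
  by rewrite cardE -(size_map val) point_setK // sz.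
rewrite /is_key /=; congr (~~ _); apply/mapP/idP => [[l' l'l e]|ll].
  by rewrite (point_set_inj hl (lines_sorted l'l) e).
by exists l.
Qed.

Lemma sort3P (a b c : 'I_10) : uniq [:: a; b; c] ->
  [/\ sorted_points (sort3 a b c), size (sort3 a b c) = 3%N
    & (b |: (c |: [set a]))%SET = point_set (sort3 a b c)].
Proof.
move=> u; rewrite /sort3; split; last 1 first.
- apply/setP => i; rewrite !inE mem_sort !inE -!val_eqE /=.
  by case: (_ == _); case: (_ == _); case: (_ == _).
- apply/andP; split; last by rewrite all_sort /= !ltn_ord.
  rewrite ltn_sorted_uniq_leq sort_uniq sort_sorted ?andbT; last exact: leq_total.
  by rewrite -[[:: _; _; _]]/(map val [:: a; b; c]) map_inj_uniq //; apply: val_inj.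
- by rewrite size_sort.
Qed.

Local Notation base := (basis desargues).

Definition list_basis (l : seq nat) : option base := insub (point_set l).

Definition monomial_of (m : seq nat * seq nat) : 'X_{1..#|base|} :=
  if list_basis m.1 is Some a then if list_basis m.2 is Some b then pair_monomial a b else 0%MM
  else 0%MM.

Definition is_list_basis l := [&& sorted_points l, size l == 3%N & is_key l].

Lemma list_basisP l : is_list_basis l -> exists2 b : base, list_basis l = Some b & val b =
  point_set l.
Proof.
move=> /and3P[hl /eqP sz k]; rewrite /list_basis; case: insubP => [b _ e|]; first by exists b.
by rewrite /= point_set_basis // k.
Qed.

Lemma list_basisN l : sorted_points l -> size l = 3%N -> ~~ is_key l -> list_basis l = None.
Proof.
move=> hl sz k; apply: insubN; by rewrite /= point_set_basis.
Qed.

Lemma pair_support_lists l1 l2 : sorted_points l1 -> size l1 = 3%N ->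
  sorted_points l2 -> size l2 = 3%N ->
  pair_support desargues (point_set l1) (point_set l2) =
  [seq monomial_of m | m <- [:: (l1, l2)] & is_key m.1 && is_key m.2].
Proof.
move=> h1 s1 h2 s2; rewrite /pair_support -!/(list_basis _) /=.
case k1 : (is_key l1); last by rewrite list_basisN ?k1.
have [b1 e1 _] : exists2 b : base, list_basis l1 = Some b & val b = point_set l1.
  by apply: list_basisP; rewrite /is_list_basis h1 s1 k1.
rewrite e1; case k2 : (is_key l2); last by rewrite list_basisN ?k2.
have [b2 e2 _] : exists2 b : base, list_basis l2 = Some b & val b = point_set l2.
  by apply: list_basisP; rewrite /is_list_basis h2 s2 k2.
by rewrite e2 /= /monomial_of /= e1 e2.
Qed.

Lemma three_term_support_monomials (s i j k l : 'I_10) : uniq [:: s; i; j; k; l] ->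
  three_term_support desargues [set s]%SET i j k l =
  [seq monomial_of m | m <- monomials (val s, val i, val j, val k, val l)].
Proof.
move=> u; rewrite /three_term_support /monomials.
have u3 a b : a \in [:: i; j; k; l] -> b \in [:: i; j; k; l] -> a != b -> uniq [:: s; a; b].
  move=> ha hb ab; move: u; rewrite cons_uniq => /andP[su _].
  rewrite /= !inE ab !andbT negb_or.
  by apply/andP; split; apply: contraNneq su => ->.
move: (u); rewrite /= !inE !negb_or !andbT => /and4P[/and4P[si sj sk sl] /and3P[ij ik il] /andP[jk
  jl] kl].
have [p1 q1 ->] := sort3P (u3 i j ltac:(by rewrite !inE eqxx ?orbT) ltac:(by rewrite !inE eqxx
  ?orbT) ij).
have [p2 q2 ->] := sort3P (u3 i k ltac:(by rewrite !inE eqxx ?orbT) ltac:(by rewrite !inE eqxx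
  ?orbT) ik).
have [p3 q3 ->] := sort3P (u3 i l ltac:(by rewrite !inE eqxx ?orbT) ltac:(by rewrite !inE eqxx
  ?orbT) il).
have [p4 q4 ->] := sort3P (u3 j k ltac:(by rewrite !inE eqxx ?orbT) ltac:(by rewrite !inE eqxx
  ?orbT) jk).
have [p5 q5 ->] := sort3P (u3 j l ltac:(by rewrite !inE eqxx ?orbT) ltac:(by rewrite !inE eqxx
  ?orbT) jl).
have [p6 q6 ->] := sort3P (u3 k l ltac:(by rewrite !inE eqxx ?orbT) ltac:(by rewrite !inE eqxx
  ?orbT) kl).
rewrite !pair_support_lists //.
by rewrite -!map_cat -!filter_cat.
Qed.

Lemma monomials_ordinal_list_basis (s i j k l : 'I_10) m : uniq [:: s; i; j; k; l] ->
  m \in monomials (val s, val i, val j, val k, val l) -> is_list_basis m.1 && is_list_basis m.2.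
Proof.
move=> u; rewrite mem_filter => /andP[/andP[k1 k2]].
rewrite /is_list_basis k1 k2 !andbT.
have u3 a b : a \in [:: i; j; k; l] -> b \in [:: i; j; k; l] -> a != b -> uniq [:: s; a; b].
  move=> ha hb ab; move: u; rewrite cons_uniq => /andP[su _].
  rewrite /= !inE ab !andbT negb_or.
  by apply/andP; split; apply: contraNneq su => ->.
move: (u); rewrite /= !inE !negb_or !andbT => /and4P[/and4P[si sj sk sl] /and3P[ij ik il] /andP[jk
  jl] kl].
have h a b : a \in [:: i; j; k; l] -> b \in [:: i; j; k; l] -> a != b ->
    sorted_points (sort3 s a b) && (size (sort3 s a b) == 3%N).
  by move=> ha hb ab; have [-> -> _] := sort3P (u3 a b ha hb ab).
by move=> /or3P[] /eqP -> /=; rewrite !h // !inE eqxx ?orbT.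
Qed.

Lemma ordinal_relation q : valid_relation q -> exists s i j k l : 'I_10,
  q = (val s, val i, val j, val k, val l) /\ uniq [:: s; i; j; k; l].
Proof.
case: q => [[[[s i] j] k] l] /andP[u /= /and5P[hs hi hj hk /andP[hl _]]].
exists (Ordinal hs), (Ordinal hi), (Ordinal hj), (Ordinal hk), (Ordinal hl); split=> //.
Qed.

Lemma monomials_list_basis q m : valid_relation q -> m \in monomials q ->
  is_list_basis m.1 && is_list_basis m.2.
Proof.
by move=> /ordinal_relation[s [i [j [k [l [-> u]]]]]]; apply: monomials_ordinal_list_basis.
Qed.

Local Notation fs := (three_term_seq desargues).

Lemma relation_polynomial q : valid_relation q ->
  exists2 f, f \in fs & perm_eq (msupp f) [seq monomial_of m | m <- monomials q].
Proof.
move=> /ordinal_relation[s [i [j [k [l [-> u]]]]]].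
have [sn u4] : all (fun x => x \notin [set s]%SET) [:: i; j; k; l] /\ uniq [:: i; j; k; l].
  move: u; rewrite cons_uniq => /andP[su ->]; split=> //; apply/allP => x hx.
  by rewrite inE; apply: contraNneq su => <-.
exists (three_term desargues [set s]%SET i j k l).
  by apply/three_term_seqP; exists [set s]%SET, i, j, k, l; split=> //; rewrite cards1.
by rewrite -three_term_support_monomials // three_term_msupp.
Qed.

Lemma ordered_relation_wlog (s i j k l : 'I_10) (P : 'I_10 -> 'I_10 -> 'I_10 -> 'I_10 -> Prop) :
 (forall i j k l, P i j k l -> P j i k l) -> (forall i j k l, P i j k l -> P i j l k) ->
 (forall i j k l, P i j k l -> P k l i j) ->
 (forall i j k l : 'I_10, uniq [:: s; i; j; k;
   l] -> (i < j)%N -> (k < l)%N -> (i < k)%N -> P i j k l) ->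
 uniq [:: s; i; j; k; l] -> P i j k l.
Proof.
move=> P12 P34 PP Pmain; move: i j k l.
have Pikj (i j k l : 'I_10) : uniq [:: s; i; j; k; l] -> (i < j)%N -> (k < l)%N -> P i j k l.
  move=> u' ij kl; case: (ltngtP i k) => [ik|ki|/val_inj ik]; first exact: Pmain.
    apply: PP; apply: Pmain => //; move: u'; rewrite !cons_uniq !inE !negb_or.
    by rewrite (eq_sym k i) (eq_sym l i) (eq_sym k j) (eq_sym l j); do ?case: (_ == _).
  by move: u'; rewrite ik !cons_uniq !inE eqxx !orbT /= andbF.
have Pij (i j k l : 'I_10) : uniq [:: s; i; j; k; l] -> (i < j)%N -> P i j k l.
  move=> u' ij; case: (ltngtP k l) => [kl|lk|/val_inj kl]; first exact: Pikj.
    apply: P34; apply: Pikj => //; move: u'; rewrite !cons_uniq !inE !negb_or.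
    by rewrite (eq_sym l k); do ?case: (_ == _).
  by move: u'; rewrite kl !cons_uniq !inE eqxx /= !andbF.
move=> i j k l u'; case: (ltngtP i j) => [ij|ji|/val_inj ij]; first exact: Pij.
  apply: P12; apply: Pij => //; move: u'; rewrite !cons_uniq !inE !negb_or.
  by rewrite (eq_sym j i); do ?case: (_ == _).
by move: u'; rewrite ij !cons_uniq !inE eqxx /= !andbF.
Qed.

Lemma polynomial_relation f : f \in fs -> exists q,
  [/\ valid_relation q, classified q & perm_eq (msupp f) [seq monomial_of m | m <- monomials q]].
Proof.
move=> /three_term_seqP[S [i [j [k [l [hS u4 sn ->]]]]]].
have /cards1P[s eS] : #|S| == 1%N by lia.
rewrite {}eS in sn *.
have u : uniq [:: s; i; j; k; l].
  rewrite cons_uniq u4 andbT; apply/negP => /(allP sn).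
  by rewrite inE eqxx.
pose P (i j k l : 'I_10) := exists q, [/\ valid_relation q, classified q &
    perm_eq (three_term_support desargues [set s]%SET i j k l) [seq monomial_of m | m <- monomials
      q]].
suff : P i j k l.
  move=> [q [vq cq pq]]; exists q; split=> //.
  exact: perm_trans (three_term_msupp desargues u4 sn) pq.
move: u; apply: ordered_relation_wlog.
- move=> i' j' k' l' [q [vq cq pq]]; exists q; split=> //.
  by rewrite (permPl (three_term_support_swap12 _ _ _ _ _ _)).
- move=> i' j' k' l' [q [vq cq pq]]; exists q; split=> //.
  by rewrite (permPl (three_term_support_swap34 _ _ _ _ _ _)).
- move=> i' j' k' l' [q [vq cq pq]]; exists q; split=> //.
  by rewrite (permPl (three_term_support_swap_pairs _ _ _ _ _ _)).
move=> i' j' k' l' u' ij kl ik; exists (val s, val i', val j', val k', val l').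
have uv : uniq [:: val s; val i'; val j'; val k'; val l'].
  by rewrite -[[:: _; _; _; _; _]]/(map val [:: s; i'; j'; k'; l']) map_inj_uniq //; apply: val_inj.
split; last by rewrite three_term_support_monomials.
  by rewrite /valid_relation uv /= !ltn_ord.
apply: (for_relationsP all_classified); rewrite ?ltn_ord //.
by rewrite /ordered_relation uv ij kl ik.
Qed.

End DesarguesRelations.

(** * From the Dressian to the model *)

Section DesarguesModel.
Local Open Scope ring_scope.

Local Arguments minimal : simpl never.

Section Models.
Variable R : realType.
Local Notation base := (basis desargues).
Local Notation fs := (three_term_seq desargues).
Local Notation V := {ffun base -> R^o}.
Local Notation X := {ffun 'I_15 -> R^o}.
Local Notation prevariety := (@trop_prevariety R base fs).
Local Notation min_le := (@min_le R base fs).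
Implicit Types (v w : V) (x y : X) (q : relation) (l : seq nat).

Definition list_value w l : R := if list_basis l is Some b then w b else 0.

Definition monomial_value w (m : seq nat * seq nat) : R :=
  list_value w m.1 + list_value w m.2.

Lemma trop_monomial_of w q m : valid_relation q -> m \in monomials q ->
  trop_monomial (monomial_of m) w = monomial_value w m.
Proof.
move=> vq /(monomials_list_basis vq)/andP[/list_basisP[a ea _] /list_basisP[b eb _]].
by rewrite /monomial_of /monomial_value /list_value ea eb trop_pair_monomial.
Qed.

Lemma attains_minP f q w m : valid_relation q ->
  perm_eq (msupp f) [seq monomial_of m | m <- monomials q] -> m \in monomials q ->
  attains_min f w (monomial_of m) <->
  forall m', m' \in monomials q -> monomial_value w m <= monomial_value w m'.
Proof.
move=> vq pf mq; split=> [[_ h] m' m'q|h].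
  rewrite -!(trop_monomial_of _ vq) //; apply: h.
  by rewrite (perm_mem pf) map_f.
split; first by rewrite (perm_mem pf) map_f.
move=> u'; rewrite (perm_mem pf) => /mapP[m' m'q ->].
by rewrite !(trop_monomial_of _ vq) //; apply: h.
Qed.

(** The function [c] is the torus part, given by rescaling each point of the configuration. *)
Definition models w x : Prop := exists c : nat -> R, forall l, is_list_basis l ->
  list_value w l = mdot (weight l) x + \sum_(p <- l) c p.

(** Each product uses the point s twice and i, j, k, l once, so the torus part adds the same
    constant [C] to all monomials. *)
Lemma models_monomials q : valid_relation q -> forall w x, models w x ->
  exists C, forall m, m \in monomials q ->
    monomial_value w m = mdot (weight m.1 ++ weight m.2) x + C.
Proof.
case: q => [[[[s i] j] k] l] vq w x [c hc].
exists (c s + c i + c j + (c s + c k + c l)) => m mq.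
have /andP[k1 k2] := monomials_list_basis vq mq.
rewrite /monomial_value !hc // mdot_cat addrACA; congr (_ + _).
have S3 a b d : \sum_(p <- sort3 a b d) c p = c a + c b + c d.
  by rewrite /sort3 (perm_big [:: a; b; d]) ?perm_sort // !big_cons big_nil /= addr0 addrA.
move: mq; rewrite mem_filter => /andP[_]; rewrite !inE => /or3P[] /eqP -> /=;
  rewrite !S3; ring.
Qed.

Definition trinomial_relation q : bool :=
  let es := exponents q in
  [&& size es == 3, size (reduced es) == 3
    & all (fun p => perm_eq p.1 (p.2 ++ common_part es)) (zip es (reduced es))].

Lemma trinomial_values q : valid_relation q -> trinomial_relation q ->
  exists m1 m2 m3 t1 t2 t3, [/\ monomials q = [:: m1; m2; m3],
    reduced (exponents q) = [:: t1; t2; t3] &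
    forall w x, models w x -> exists C, [/\ monomial_value w m1 = mdot t1 x + C,
      monomial_value w m2 = mdot t2 x + C & monomial_value w m3 = mdot t3 x + C]].
Proof.
move=> vq /and3P[]; have hv := models_monomials vq; move: hv.
rewrite /exponents size_map; set c := common_part _.
case: (monomials q) => [|m1 [|m2 [|m3 []]]] // hv _.
set t := reduced _; case et : t => [|t1 [|t2 [|t3 []]]] // _ /and4P[/= p1 p2 p3 _].
exists m1, m2, m3, t1, t2, t3; split=> // w x /hv[C hC].
exists (mdot c x + C).
by split; rewrite hC ?inE ?eqxx ?orbT // (mdot_perm _ p1, mdot_perm _ p2, mdot_perm _ p3) mdot_cat
  addrA.
Qed.

Lemma constant_values q : valid_relation q ->
  all (perm_eq (nth [::] (exponents q) 0)) (exponents q) ->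
  forall w x, models w x -> forall m m', m \in monomials q -> m' \in monomials q ->
  monomial_value w m = monomial_value w m'.
Proof.
move=> vq /allP h w x /(models_monomials vq)[C hC] m m' mq m'q.
have e := h _ (map_f (fun m => weight m.1 ++ weight m.2) mq).
have e' := h _ (map_f (fun m => weight m.1 ++ weight m.2) m'q).
by rewrite !hC // -(mdot_perm _ e) -(mdot_perm _ e').
Qed.

Lemma trinomial_relation_minimal q : valid_relation q -> trinomial_relation q ->
  exists m1 m2 m3 t1 t2 t3, [/\ monomials q = [:: m1; m2; m3],
    reduced (exponents q) = [:: t1; t2; t3] &
    forall w x f, models w x -> perm_eq (msupp f) [seq monomial_of m | m <- monomials q] ->
    [/\ attains_min f w (monomial_of m1) <-> minimal [:: t1; t2; t3] x t1,
        attains_min f w (monomial_of m2) <-> minimal [:: t1; t2; t3] x t2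
      & attains_min f w (monomial_of m3) <-> minimal [:: t1; t2; t3] x t3]].
Proof.
move=> vq tq; have [m1 [m2 [m3 [t1 [t2 [t3 [em et hv]]]]]]] := trinomial_values vq tq.
exists m1, m2, m3, t1, t2, t3; split=> // w x f /hv[C [e1 e2 e3]] pf.
have val3 (P : seq nat * seq nat -> Prop) : (forall m, m \in monomials q -> P m) <-> [/\ P m1, P
  m2 & P m3].
  rewrite em; split=> [h|[h1 h2 h3] m]; first by split; apply: h; rewrite !inE eqxx ?orbT.
  by rewrite !inE => /or3P[] /eqP ->.
have main m t : m \in monomials q -> monomial_value w m = mdot t x + C ->
    attains_min f w (monomial_of m) <-> minimal [:: t1; t2; t3] x t.
  move=> mq e; apply: (iff_trans (attains_minP w vq pf mq)); apply: (iff_trans (val3 _)).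
  rewrite e e1 e2 e3 !lerD2r /minimal /= !andbT.
  by split=> [[-> -> ->]|/and3P[-> -> ->]].
by split; apply: main; rewrite ?em ?inE ?eqxx ?orbT.
Qed.

Lemma minimal_perm t t' x : perm_eq t t' -> minimal t x =1 minimal t' x.
Proof. by move=> p m; apply: perm_all. Qed.

Lemma representative_trinomial t : t \in trinomials -> exists q,
  [/\ valid_relation q, trinomial_relation q & t = reduced (exponents q)].
Proof.
move=> tT; have /and3P[sz _ _] := allP trinomials_wf _ tT.
move: tT => /mapP[q qr e]; exists q; split=> //; first exact: (allP valid_representatives).
by have /andP[h1 h2] := allP representatives_ok _ qr; rewrite /trinomial_relation h1 -e sz e.
Qed.

Lemma bits_le_signature ts x y : bits_le (signature ts x) (signature ts y) <->
  forall t, t \in ts -> forall m, m \in t -> minimal t x m -> minimal t y m.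
Proof.
have lebcat a b c d' : size a = size b -> bits_le (a ++ c) (b ++ d') = bits_le a b && bits_le c d'.
  elim: a b => [|u a IH] [|v b] //= [] /IH ->.
  by case: u; case: v.
have lebmap t s : bits_le [seq minimal t x m | m <- s] [seq minimal t y m | m <- s] <->
    forall m, m \in s -> minimal t x m -> minimal t y m.
  elim: s => //= m s IH; split.
    move=> h m'; rewrite inE => /orP[/eqP -> hx|m's].
      by move: h; rewrite hx; case: (minimal t y m).
    move: h; case: ifP => // _ /IH; exact.
  move=> h; case hx : (minimal t x m); first rewrite (h m (mem_head _ _) hx).
    by apply/IH => m' m's; apply: h; rewrite inE m's orbT.
  by apply/IH => m' m's; apply: h; rewrite inE m's orbT.
elim: ts => //= t ts IH; rewrite /signature /= lebcat ?size_map // -!/(signature ts _).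
split=> [/andP[/lebmap h /IH h'] t'|h].
  by rewrite inE => /orP[/eqP -> //|]; apply: h'.
apply/andP; split; first by apply/lebmap => m mt; apply: h; rewrite ?mem_head.
by apply/IH => t' t'ts; apply: h; rewrite inE t'ts orbT.
Qed.

Lemma classifiedP q : classified q ->
  [/\ (1 < size (monomials q))%N &
    all (perm_eq (nth [::] (exponents q) 0)) (exponents q) \/
    (trinomial_relation q /\ exists2 t, t \in trinomials & perm_eq (reduced (exponents q)) t)].
Proof.
rewrite /classified /trinomial_relation => /andP[sz].
have sz' : (1 < size (monomials q))%N by move: sz; rewrite size_map.
case: ifP => [h _|_]; first by split=> //; left.
move=> /and4P[h1 /hasP[t tT p] h2 h3]; split=> //; right.
by split; [rewrite h1 h2 h3|exists t].
Qed.

(** The constants cancel within each relation: a relation that is an identity in the model has all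
    its monomials minimal everywhere, and any other has the same minimizers as its trinomial.
    Conversely each trinomial comes from an actual relation, its representative. *)
Lemma models_min_le w w' x x' : models w x -> models w' x' ->
  min_le w w' <-> bits_le (signature trinomials x) (signature trinomials x').
Proof.
move=> hw hw'; split=> [h|/bits_le_signature h].
  apply/bits_le_signature => t tT; have [q [vq tq et]] := representative_trinomial tT.
  have [f ff pf] := relation_polynomial vq.
  have [m1 [m2 [m3 [t1 [t2 [t3 [em et' hv]]]]]]] := trinomial_relation_minimal vq tq.
  rewrite et et' => m; rewrite !inE.
  have [a1 a2 a3] := hv _ _ _ hw pf; have [b1 b2 b3] := hv _ _ _ hw' pf.
  by move=> /or3P[] /eqP ->; [move/a1/(h f ff)/b1|move/a2/(h f ff)/b2|move/a3/(h f ff)/b3].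
move=> f ff u hu; have [q [vq /classifiedP[_ cq] pf]] := polynomial_relation ff.
have : u \in msupp f by case: hu.
rewrite (perm_mem pf) => /mapP[m mq eu]; rewrite {}eu in hu *.
case: cq => [cq|[tq [t tT pt]]].
  apply/(attains_minP _ vq pf) => // m' m'q.
  by rewrite (constant_values vq cq hw' mq m'q).
have [m1 [m2 [m3 [t1 [t2 [t3 [em et' hv]]]]]]] := trinomial_relation_minimal vq tq.
have [a1 a2 a3] := hv _ _ _ hw pf; have [b1 b2 b3] := hv _ _ _ hw' pf.
have h' m0 : m0 \in [:: t1; t2; t3] -> minimal [:: t1; t2; t3] x m0 -> minimal [:: t1; t2;
  t3] x' m0.
  move=> m0t; rewrite !(minimal_perm _ (t' := t)) -?et' //; apply: h => //.
  by rewrite -(perm_mem pt) et'.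
move: mq hu; rewrite em !inE => /or3P[] /eqP ->.
- by move/a1 => hm; apply/b1; apply: h' hm; rewrite !inE eqxx.
- by move/a2 => hm; apply/b2; apply: h' hm; rewrite !inE eqxx orbT.
- by move/a3 => hm; apply/b3; apply: h' hm; rewrite !inE eqxx !orbT.
Qed.

Lemma models_prevariety w x : models w x -> prevariety w <-> valid x.
Proof.
move=> hw; split=> [h t tT|h f ff].
  have [q [vq tq et]] := representative_trinomial tT.
  have [f ff pf] := relation_polynomial vq.
  have [m1 [m2 [m3 [t1 [t2 [t3 [em et' hv]]]]]]] := trinomial_relation_minimal vq tq.
  have [a1 a2 a3] := hv _ _ _ hw pf.
  rewrite et et' /real_minimizer_bits /=.
  case: (h f ff) => [f0|[u1 [u2 [n12 h1 h2]]]].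
    by move: (perm_size pf); rewrite f0 msupp0 em.
  move: (h1.1) (h2.1); rewrite !(perm_mem pf) em !inE => /or3P[] /eqP e1 /or3P[] /eqP e2;
    move: h1 h2 n12; rewrite e1 e2 ?eqxx //;
    first [move=> /a1 ->|move=> /a2 ->|move=> /a3 ->];
    first [move=> /a1 ->|move=> /a2 ->|move=> /a3 ->];
    by move=> _; case: (minimal _ _ _).
have [q [vq /classifiedP[sz cq] pf]] := polynomial_relation ff.
have uf : uniq [seq monomial_of m | m <- monomials q] by rewrite -(perm_uniq pf) msupp_uniq.
right; case: cq => [cq|[tq [t tT pt]]].
  have hc := constant_values vq cq hw; have at_min m mq := (attains_minP w vq pf mq (m := m)).2.
  case: (monomials q) sz uf hc at_min => [|m1 [|m2 s]] // _ /andP[n12 _] hc at_min.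
  exists (monomial_of m1), (monomial_of m2); split.
  - by move: n12; rewrite /= inE negb_or => /andP[].
  - by apply: at_min => [|m' m's]; rewrite ?mem_head // (hc m1 m') ?mem_head.
  - by apply: at_min => [|m' m's]; rewrite ?inE ?eqxx ?orbT // (hc m2 m') ?inE ?eqxx ?orbT.
have [m1 [m2 [m3 [t1 [t2 [t3 [em et' hv]]]]]]] := trinomial_relation_minimal vq tq.
have [a1 a2 a3] := hv _ _ _ hw pf.
have : (1 < count id (real_minimizer_bits [:: t1; t2; t3] x))%N.
  rewrite -et'; have := h t tT; rewrite /real_minimizer_bits !count_map.
  rewrite (permP pt) => h'; rewrite (leq_trans h') // sub_count // => m /=.
  by rewrite (minimal_perm _ pt).
move: uf; rewrite em /= !inE !negb_or !andbT => /andP[/andP[n12 n13] n23].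
case e1 : (minimal _ _ _); case e2 : (minimal _ _ _); case e3 : (minimal _ _ _) => // _.
- by exists (monomial_of m1), (monomial_of m2); split=> //; [apply/a1|apply/a2].
- by exists (monomial_of m1), (monomial_of m2); split=> //; [apply/a1|apply/a2].
- by exists (monomial_of m1), (monomial_of m3); split=> //; [apply/a1|apply/a3].
- by exists (monomial_of m2), (monomial_of m3); split=> //; [apply/a2|apply/a3].
Qed.

Lemma support_sizes f : f \in fs -> (1 < size (msupp f) <= 3)%N.
Proof.
move=> /polynomial_relation[q [vq /classifiedP[sz _] pf]].
rewrite (perm_size pf) size_map sz /=; case: q {sz vq pf} => [[[[s i] j] k] l].
by rewrite size_filter (leq_trans (count_size _ _)).
Qed.

(** The vector modelled by [x] with torus part 0. *)
Definition lift x : V := [ffun b : base => mdot (weight [seq val i | i <- enum (val b)]) x].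

Lemma lift_is_linear : linear (lift : X -> V).
Proof. by move=> a x y; apply/ffunP => b; rewrite !ffunE mdotD mdotZ. Qed.
HB.instance Definition _ := GRing.isLinear.Build R X V _ lift lift_is_linear.

Definition lift_map : 'Hom(X, V) := linfun lift.

Lemma models_lift_map x : models (lift_map x) x.
Proof.
exists (fun=> 0) => l hl; have [b eb hb] := list_basisP hl.
move: hl => /and3P[hl _ _].
by rewrite /list_value eb lfunE ffunE hb point_setK // big1 ?addr0.
Qed.

Lemma models_sub w w' x x' : models w x -> models w' x' -> models (w - w') (x - x').
Proof.
move=> [c hc] [c' hc']; exists (fun p => c p - c' p) => l hl.
rewrite mdotB sumrB; have := hc l hl; have := hc' l hl.
rewrite /list_value; case: (list_basis l) => [b|]; first by rewrite !ffunE => -> ->; ring.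
move=> h h'; move: h h'; lra.
Qed.

Definition coordinate w (j : nat) : R :=
  (\sum_(k < 24) (nth 0 (nth [::] base_coordinates j) k)%:~R * list_value w (nth [::] base_keys
    k)) / 2.

Lemma int_sumE (s : seq int) : (int_sum s)%:~R = \sum_(a <- s) a%:~R :> R.
Proof. by elim: s => [|a s IH]; rewrite ?big_nil //= big_cons rmorphD /= IH. Qed.

Lemma coordinate_base w k : (k < 24)%N ->
  \sum_(j <- extended_weight (nth [::] base_keys k)) coordinate w j =
  list_value w (nth [::] base_keys k).
Proof.
move=> k24; rewrite /coordinate -mulr_suml exchange_big /=.
rewrite (bigD1 (Ordinal k24)) //= [X in _ + X]big1 ?addr0 => [|i ik].
  rewrite -mulr_suml -(big_map (fun j => nth 0 (nth [::] base_coordinates j) k) xpredT (fun a =>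
    a%:~R)).
  rewrite -int_sumE; have := allP base_coordinatesP k; rewrite mem_iota k24 => /(_ isT)/allP/(_ k).
  rewrite mem_iota k24 eqxx => /(_ isT)/eqP ->.
  by rewrite mulrAC divff ?mul1r // pnatr_eq0.
rewrite -mulr_suml -(big_map (fun j => nth 0 (nth [::] base_coordinates j) i) xpredT (fun a =>
  a%:~R)).
rewrite -int_sumE; have := allP base_coordinatesP k; rewrite mem_iota k24 => /(_ isT)/allP/(_ i).
rewrite mem_iota /= ltn_ord => /(_ isT)/eqP ->.
have -> : (k == i) = false by apply/negbTE; apply: contraNneq ik => e; apply/eqP/val_inj.
by rewrite mul0r.
Qed.

Lemma binomial_values w q a b c d : prevariety w -> valid_relation q ->
  monomials q = [:: (a, b); (c, d)] ->
  list_value w a + list_value w b = list_value w c + list_value w d.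
Proof.
move=> hw vq em; have [f ff pf] := relation_polynomial vq.
case: (hw f ff) => [f0|[u1 [u2 [n12 h1 h2]]]].
  by move: (perm_size pf); rewrite f0 msupp0 em.
have e := attains_min_same h1 h2.
have m1 : (a, b) \in monomials q by rewrite em mem_head.
have m2 : (c, d) \in monomials q by rewrite em !inE eqxx orbT.
move: h1.1 h2.1 n12 e; rewrite !(perm_mem pf) em !inE.
move=> /orP[] /eqP -> /orP[] /eqP ->; rewrite ?eqxx // => _;
  by rewrite (trop_monomial_of _ vq m1) (trop_monomial_of _ vq m2).
Qed.

(** Applied to the difference of two solutions of the binomial relation: vanishing at three of the
    bases forces vanishing at the fourth. *)
Lemma propagateP (D : seq nat -> R) K q :
  (forall a b c d, monomials q = [:: (a, b); (c, d)] -> D a + D b = D c + D d) ->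
  {in K, forall l, D l = 0} -> {in propagate K q, forall l, D l = 0}.
Proof.
move=> hq hK; rewrite /propagate.
case: (monomials q) hq => [|[a b] [|[c d] []]] // /(_ a b c d erefl) e.
rewrite /= !mem_genP.
have z l : l \in K -> D l = 0 by apply: hK.
case aK : (a \in K) => /=; case bK : (b \in K) => /=; case cK : (c \in K) => /=;
  case dK : (d \in K) => //= l; rewrite inE => /orP[/eqP ->|/hK //].
- by move: e; rewrite !(z a, z b, z c) // => /esym; rewrite add0r addr0.
- by move: e; rewrite (z a) ?(z b) ?(z d) // addr0 => /esym; rewrite addr0.
- by move: e; rewrite (z a) ?(z c) ?(z d) // add0r addr0.
- by move: e; rewrite (z b) ?(z c) ?(z d) // !addr0.
Qed.

Lemma mem_all_keys l : is_list_basis l -> l \in all_keys.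
Proof.
move=> /and3P[/andP[sl l10] sz k]; rewrite mem_filter sl k !andTb.
case: l l10 sz {sl k} => [|a [|b [|c []]]] // /and4P[ha hb hc _] _.
have m10 p : (p \in iota 0 10) = (p < 10)%N by rewrite mem_iota.
apply/allpairsP; exists (a, [:: b; c]); split; [by rewrite m10| |by []].
by apply/allpairsP; exists (b, c); split; [rewrite m10|rewrite m10|].
Qed.

Lemma weight_lt l : is_list_basis l -> all (ltn^~ 15)%N (weight l).
Proof.
have : all (fun l => all (ltn^~ 15)%N (weight l)) all_keys by vm_compute.
by move=> /allP h /mem_all_keys /h.
Qed.

(** Coordinates are read off from the values at the base keys, and [w0] is the vector they model.
    Both [w] and [w0] satisfy the binomial relations and they agree on the base keys, so propagation
    makes them agree on all bases. *)
Lemma prevariety_models w : prevariety w -> exists x, models w x.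
Proof.
move=> hw; pose x : X := [ffun i : 'I_15 => coordinate w i].
pose c p := coordinate w (15 + p).
pose w0 : V := [ffun b : base => mdot (weight [seq val i | i <- enum (val b)]) x +
  \sum_(p <- [seq val i | i <- enum (val b)]) c p].
have w0E l : is_list_basis l -> list_value w0 l = mdot (weight l) x + \sum_(p <- l) c p.
  move=> hl; have [b eb hb] := list_basisP hl; move: hl => /and3P[hl _ _].
  by rewrite /list_value eb ffunE hb point_setK.
have w0x : models w0 x by exists c.
suff e l : is_list_basis l -> list_value w l - list_value w0 l = 0.
  by exists x, c => l hl; rewrite -w0E //; apply/eqP; rewrite -subr_eq0 e.
move=> /mem_all_keys /(allP propagation_complete); rewrite mem_genP.
have h0 : {in base_keys, forall l, list_value w l - list_value w0 l = 0}.
  have hb : all is_list_basis base_keys by vm_compute.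
  move=> l' l'b; have hl' := allP hb _ l'b; rewrite w0E //.
  have k24 : (index l' base_keys < 24)%N by rewrite -[24%N]/(size base_keys) index_mem.
  have := coordinate_base w k24; rewrite nth_index // /extended_weight big_cat /= big_map.
  move=> <-; apply/eqP; rewrite subr_eq0 -subr_eq0 opprD addrACA subrr addr0 subr_eq0; apply/eqP.
  rewrite /mdot big_seq [RHS]big_seq; apply: eq_bigr => j /(allP (weight_lt hl')) j15.
  by rewrite ffunE inordK.
have := propagation_steps_binomial; have := valid_propagation_steps.
elim: propagation_steps base_keys h0 => [|q s IH] K hK; first by move=> _ _ /hK.
move=> /andP[vq hs] /andP[bq hbs]; apply: IH => //.
apply: (@propagateP (fun l => list_value w l - list_value w0 l)) => // a b a' b' em.
have := binomial_values hw vq em; have := constant_values vq bq w0x (m := (a, b)) (m' := (a', b')).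
rewrite em !inE !eqxx orbT /monomial_value /= => /(_ isT isT); lra.
Qed.

End Models.

End DesarguesModel.

(** * Cells *)

Section Conclusion.
Local Open Scope ring_scope.
Local Open Scope classical_set_scope.
Local Open Scope card_scope.

Lemma attained_twice_signature (R : realType) ts (x : {ffun 'I_15 -> R^o}) : all wf_trinomial ts ->
  attained_twice (signature ts x) <-> forall t, t \in ts -> (1 < count id (real_minimizer_bits t
    x))%N.
Proof.
elim: ts => // t ts IH /andP[/wf_trinomialE[m1 [m2 [m3 [-> _]]]] /IH {}IH].
rewrite /signature /= -/(signature ts x); split.
  move=> /andP[h /IH h'] t'; rewrite inE => /orP[/eqP ->|]; last exact: h'.
  by rewrite /real_minimizer_bits /= !addn0 addnA.
move=> h; apply/andP; split; last by apply/IH => t' t'ts; apply: h; rewrite inE t'ts orbT.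
have := h _ (mem_head _ _); by rewrite /real_minimizer_bits /= !addn0 addnA.
Qed.

Lemma card_uniq_image (T : eqType) (U : Type) (S : seq T) (f : T -> U) n :
  uniq S -> size S = n -> {in S &, injective f} -> f @` [set` S] #= `I_n.
Proof.
move=> uS <- inj; case eS : S => [|x0 S0].
  have -> : [set` [::]] = set0 :> set T by apply/seteqP; split=> x.
  rewrite image_set0; have -> : `I_0 = set0 by apply/seteqP; split=> x.
  by rewrite card_eq0 eqxx.
rewrite -eS.
have -> : f @` [set` S] = (fun i => f (nth x0 S i)) @` `I_(size S).
  apply/seteqP; split=> y [].
    by move=> x /= xS <-; exists (index x S); rewrite /= ?index_mem ?nth_index.
  by move=> i /= lt <-; exists (nth x0 S i) => //=; rewrite mem_nth.
apply: inj_card_eq => i j; rewrite !inE /= => li lj /inj e.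
by apply/eqP; rewrite -(nth_uniq x0 li lj uS) e ?mem_nth.
Qed.

Section Cells.
Variable R : realType.
Local Notation base := (basis desargues).
Local Notation fs := (three_term_seq desargues).
Local Notation V := {ffun base -> R^o}.
Local Notation X := {ffun 'I_15 -> R^o}.
Local Notation prevariety := (@trop_prevariety R base fs).
Local Notation min_le := (@min_le R base fs).
Local Notation sig := (@signature R trinomials).
Implicit Types (v w : V) (x y z : X) (s : seq bool).

Variable L : {vspace V}.
Hypothesis LP : forall w, w \in L <->
  (forall f, f \in fs -> forall u u', u \in msupp f -> u' \in msupp f ->
     trop_monomial u w = trop_monomial u' w).

Lemma models_lineality w x : models w x -> w \in L <-> all id (sig x).
Proof.
move=> hw; have h0 : models (0 : V) 0 by rewrite -(linear0 (@lift_map R)); apply: models_lift_map.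
have -> : all id (sig x) = bits_le (sig 0) (sig x).
  rewrite -(scale0r (one_vec R)) (signature_one _ trinomials_wf) bits_le_full; first by [].
  by rewrite size_signature; [|exact: trinomials_wf].
apply: iff_trans (models_min_le h0 hw); split=> [/LP h f ff u [uf _]|h].
  by split=> // u' u'f; rewrite (h f ff u u').
apply/LP => f ff u u' uf u'f.
by apply: (@attains_min_same _ _ f); apply: h => //; apply: attains_min0.
Qed.

Variable P : seq (seq (seq nat)).
Hypothesis P_certificate : certificate P.
Hypothesis P_cover : forall x, valid x -> exists2 G, G \in P & cone G x.

Variables (W : vectType R) (proj : 'Hom(V, W)) (dot : {dot W for @idfun R}) (r : R).
Hypotheses (ker_proj : lker proj = L) (im_proj : limg proj = fullv) (r0 : 0 < r).

Local Notation cell := (@cell R base fs W proj dot r).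

(** A point whose signature is full is spanned by the all-one vector and the generators of full
    signature, of which there are none. *)
Lemma lift_map_lineality x : (proj \o @lift_map R)%VF x = 0 -> exists a, x = a *: one_vec R.
Proof.
rewrite comp_lfunE => /(proj_eq0 ker_proj)/(models_lineality (models_lift_map x)) full.
have vx : valid x.
  apply/(attained_twice_signature x trinomials_wf).
  have : sig x = full_bits.
    by rewrite /full_bits -(size_signature_trinomials x); apply/all_pred1P;
      apply: sub_all full => -[].
  by move=> ->.
have hs : bits_le (full_bits) (sig x) by rewrite bits_le_full ?size_signature_trinomials.
have := cone_generators_span P_certificate P_cover vx hs.
suff -> : cone_generators P (full_bits) = [::] by rewrite span_seq1 => /vlineP.
apply/eqP; rewrite -[_ == _]negbK -has_filter; apply/hasPn => g /(generator_not_full P_certificate).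
by rewrite bits_le_full ?size_bits.
Qed.

Lemma lift_map_one : (proj \o @lift_map R)%VF (one_vec R) = 0.
Proof.
rewrite comp_lfunE; apply/(proj_eq0 ker_proj)/(models_lineality (models_lift_map _)).
by rewrite -[one_vec R]scale1r signature_one ?trinomials_wf // all_nseq orbT.
Qed.

(** The lifted generators whose signatures contain that of [x] lie in the cone of [v] and span it
    modulo [L]; it remains to see that lifting and projecting keep the rank of their normalized
    vectors. *)
Lemma cell_dim_signature v x i : prevariety v -> models v x ->
  cell_dim (cell v) i <-> signature_dim P (sig x) = i.+1.
Proof.
move=> hv hx; pose Y := [seq @lift_map R (vec R g) | g <- cone_generators P (sig x)].
have hY (y : V) : y \in Y -> min_le v y.
  move=> /mapP[g]; rewrite mem_filter => /andP[hg _ ->].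
  by apply/(models_min_le hx (models_lift_map _)); rewrite signature_trinomials_vec.
have hspan w : min_le v w -> exists2 u, u \in L & w - u \in <<Y>>%VS.
  move=> hw; have pw := min_le_prevariety hw hv.
  have [y hy] := prevariety_models pw.
  have vy : valid y by apply/(models_prevariety hy).
  have ly : bits_le (sig x) (sig y) by apply/(models_min_le hx hy).
  have := cone_generators_span P_certificate P_cover vy ly.
  rewrite span_cons => /memv_addP[_ /vlineP[a ->] [z hz ey]].
  (* Here [y] is [z] plus a multiple of the all-one vector, so the difference is modelled by that
     multiple and lies in the lineality space. *)
  exists (w - lift_map R z); last by rewrite opprB addrC subrK /Y map_comp -limg_span memv_img.
  apply/(models_lineality (models_sub hy (models_lift_map z))).
  by rewrite ey addrK signature_one ?trinomials_wf // all_nseq orbT.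
apply: (iff_trans (cell_dimP LP dot ker_proj r0 i hY hspan)).
suff -> : \dim (proj @: <<Y>>) = signature_dim P (sig x) by [].
have -> : (proj @: <<Y>> = (proj \o @lift_map R) @: <<[seq normal_vec R g | g <- cone_generators P
  (sig x)]>>)%VS.
  rewrite !limg_span -!map_comp; congr (<<_>>)%VS; apply: eq_map => g /=.
  by rewrite /normal_vec linearB linearZ /= lift_map_one scaler0 subr0 comp_lfunE.
(* The kernel consists of multiples of the all-one vector, and first coordinates vanish on the span,
   so the two meet in 0. *)
rewrite limg_dim_eq ?(dim_cone_generators R P_certificate) //.
apply/eqP; rewrite -subv0; apply/subvP => z;
  rewrite memv_cap memv_ker => /andP[hz /eqP/lift_map_lineality[a ez]].
suff z0 : z ord0 = 0 by move: z0; rewrite ez memv0 !ffunE [_ *: _]mulr1 => ->; rewrite scale0r.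
rewrite (coord_span (X := in_tuple [seq normal_vec R g | g <- cone_generators P (sig x)]) hz).
rewrite sum_ffunE big1 // => j _; rewrite ffunE -tnth_nth.
have /mapP[g _ ->] := mem_tnth j (in_tuple [seq normal_vec R g | g <- cone_generators P (sig x)]).
by rewrite !ffunE [_%:R *: 1]mulr1 subrr scaler0.
Qed.

(** The implication sits under the quantifier so that [choice] gives a point for every list of bits;
    0 is a dummy value. *)
Lemma signature_point s : exists x, s \in signatures P -> sig x = s.
Proof.
case: (boolP (s \in signatures P)) => [/(signature_realized R P_certificate)[x e]|_].
  by exists x.
by exists 0.
Qed.

Let K := spherical_section dot r proj (dressian_fan R desargues).

(** Signatures of positive dimension name the nonempty cells faithfully. The full signature belongs
    to the lineality space, which misses the sphere after projection; it has dimension 0 and is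
    thereby excluded. *)
Lemma section_cells : exists D : seq bool -> set W,
  [/\ forall s, s \in signatures P -> (0 < signature_dim P s)%N -> K (D s),
      forall C, K C -> exists2 s, s \in signatures P & C = D s,
      forall s s', s \in signatures P -> s' \in signatures P -> (0 < signature_dim P s)%N ->
        (0 < signature_dim P s')%N -> D s = D s' -> s = s'
    & forall s i, s \in signatures P -> cell_dim (D s) i <-> signature_dim P s = i.+1].
Proof.
have [pt hpt] := choice signature_point.
have pv s : s \in signatures P -> prevariety (lift_map R (pt s)).
  move=> sS; apply/(models_prevariety (models_lift_map _))/(attained_twice_signature _
    trinomials_wf).
  by rewrite hpt //; apply: attained_twice_signatures sS.
have dimE s i : s \in signatures P -> cell_dim (cell (lift_map R (pt s))) i <-> signature_dim P s
  = i.+1.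
  move=> sS; have := cell_dim_signature i (pv s sS) (models_lift_map (pt s)).
  by rewrite hpt.
have notL s : s \in signatures P -> (0 < signature_dim P s)%N -> lift_map R (pt s) \notin L.
  move=> sS; apply: contraL => /(models_lineality (models_lift_map _)); rewrite hpt // => full.
  rewrite -leqNgt -(dim_cone_generators R P_certificate).
  suff -> : cone_generators P s = [::] by rewrite span_nil dimv0.
  apply/eqP; rewrite -[_ == _]negbK -has_filter; apply/hasPn => g gP.
  have es : s = full_bits.
    by rewrite -(hpt s sS) /full_bits -(size_signature_trinomials (pt s)); apply/all_pred1P;
      rewrite hpt //; apply: sub_all full => -[].
  by rewrite es bits_le_full ?size_bits //; apply: generator_not_full gP.
have KP := spherical_sectionP LP dot ker_proj im_proj r0.
exists (fun s => cell (lift_map R (pt s))); split=> //.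
- move=> s sS d0; rewrite /K dressian_fanE; apply/KP.
  by exists (lift_map R (pt s)); split=> //; [apply: pv|apply: notL].
- move=> C; rewrite /K dressian_fanE => /KP[v [hv vL ->]].
  have [x hx] := prevariety_models hv; have vx : valid x by apply/(models_prevariety hx).
  have sS := valid_signature P_certificate P_cover vx; exists (sig x) => //.
  have e := hpt _ sS.
  have h1 : min_le v (lift_map R (pt (sig x))).
    by apply/(models_min_le hx (models_lift_map _)); rewrite e bits_le_refl.
  have h2 : min_le (lift_map R (pt (sig x))) v.
    by apply/(models_min_le (models_lift_map _) hx); rewrite e bits_le_refl.
  apply/(cell_eqP LP dot ker_proj im_proj r0) => //.
  by apply: contra vL => h; apply: (min_le_lineality LP h h2).
- move=> s s' sS s'S d d' /(cell_eqP LP dot ker_proj im_proj r0 (notL s sS d) (notL s' s'S d'))[].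
  move=> /(models_min_le (models_lift_map _) (models_lift_map _)) h1 /(models_min_le
    (models_lift_map _) (models_lift_map _)) h2.
  by rewrite -(hpt s sS) -(hpt s' s'S); apply: bits_le_anti h1 h2;
    rewrite !size_signature_trinomials.
Qed.

Lemma cells_card i : (i < 4)%N -> cells K i #= `I_(nth 0%N [:: 70; 370; 510; 150]%N i).
Proof.
move=> i4; have [D [DK KD Dinj Ddim]] := section_cells.
pose S := [seq s <- signatures P | signature_dim P s == i.+1].
have -> : cells K i = D @` [set` S].
  apply/seteqP; split=> C.
    move=> [/KD[s sS ->] /(Ddim s i sS) e]; exists s => //=.
    by rewrite mem_filter e eqxx.
  move=> [s]; rewrite /= mem_filter => /andP[/eqP e sS] <-; split; last exact/Ddim.
  by apply: DK; rewrite ?e.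
apply: card_uniq_image.
- by rewrite filter_uniq // uniq_signatures.
- by rewrite size_filter (count_signature_dim P_certificate).
move=> s s'; rewrite !mem_filter => /andP[/eqP e sS] /andP[/eqP e' s'S].
by apply: Dinj; rewrite ?e ?e'.
Qed.

Lemma section_finite : finite_set K.
Proof.
have [D [_ KD _ _]] := section_cells.
apply: (@sub_finite_set _ _ (D @` [set` signatures P])); last exact/finite_image/finite_seq.
by move=> C /KD[s sS ->]; exists s.
Qed.

Lemma section_dim : complex_dim K 3.
Proof.
have [D [DK KD Dinj Ddim]] := section_cells; split.
  have : has (fun s => signature_dim P s == 4%N) (signatures P).
    by rewrite has_count (@count_signature_dim _ P_certificate 3).
  move=> /hasP[s sS /eqP e]; exists (D s); first by apply: DK; rewrite ?e.
  exact/Ddim.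
move=> C i /KD[s sS ->] /(Ddim s i sS) e.
by rewrite -ltnS -e; apply: signature_dim_le.
Qed.

End Cells.

End Conclusion.

Local Open Scope ring_scope.
Local Open Scope classical_set_scope.
Local Open Scope card_scope.

Theorem proposition4p4 (R : realType) :
  exists L : {vspace {ffun basis desargues -> R^o}},
    is_lineality_space (dressian R desargues) L /\
    forall (W : vectType R)
           (proj : 'Hom({ffun basis desargues -> R^o}, W))
           (dot : {dot W for @idfun R}) (r : R),
      lker proj = L -> limg proj = fullv -> 0 < r ->
      let K := spherical_section dot r proj (dressian_fan R desargues) in
      [/\ spherical_complex dot r K,
          complex_dim K 3
        & [/\ cells K 0 #= `I_70,
              cells K 1 #= `I_370,
              cells K 2 #= `I_510
            & cells K 3 #= `I_150]].
Proof.
have [L isL LP] := @lineality_exists R _ (three_term_seq desargues) (fun f ff _ => support_sizes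
  ff).
exists L; rewrite dressianE; split=> // W proj dot r ker_proj im_proj r0 K.
have fin := section_finite LP pieces_certificate (@pieces_cover R) dot ker_proj im_proj r0.
have card i := @cells_card R L LP _ pieces_certificate (@pieces_cover R) W proj dot r ker_proj
  im_proj r0 i.
split; last by split; [exact: (card 0%N)|exact: (card 1%N)|exact: (card 2%N)|exact: (card 3%N)].
  move: fin; rewrite /K dressian_fanE.
  exact: (section_is_complex LP ker_proj im_proj r0).
exact: (@section_dim R L LP _ pieces_certificate (@pieces_cover R) W proj dot r ker_proj im_proj
  r0).
Qed.
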